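(* Let $p\in\mathbb{C}[z_1,z_2]$ be semi-stable of bidegree $(n,m)$. Let $g\in\mathbb{C}[z_2]$ be the $\mathbb{T}$-factor of $\det E_1(z_2)$ and $h\in\mathbb{C}[z_1]$ the $\mathbb{T}$-factor of $\det E_2(z_1)$. Then $g(z_2)h(z_1)\,\mathcal{I}_p\subset\mathcal{I}_p^\infty$.
   Context: $\mathbb{D}$ is the open unit disk, $\mathbb{T}$ the unit circle, $\sigma$ normalized Lebesgue measure on $\mathbb{T}^2$. For $p$ of bidegree $(n,m)$, $\tilde p(z)=z_1^nz_2^m\overline{p(1/\bar z_1,1/\bar z_2)}$; $p$ is semi-stable if it has no zeros in $\mathbb{D}^2$ and $p,\tilde p$ have no common factor. $\mathcal{I}_p=\{q\in\mathbb{C}[z_1,z_2]:q/p\in L^2(\mathbb{T}^2)\}$ and $\mathcal{I}_p^\infty=\{q\in\mathbb{C}[z_1,z_2]:q/p\in L^\infty(\mathbb{T}^2)\}$. In the Hilbert space $L^2(\frac{1}{|p|^2}d\sigma)$ let $\mathcal{P}_{j,k}$ be the polynomials of bidegree at most $(j,k)$ in this space, and $\mathcal{E}_1=\mathcal{P}_{n-1,m}\ominus z_2\mathcal{P}_{n-1,m-1}$ (dimension $n$), $\mathcal{E}_2=\mathcal{P}_{n,m-1}\ominus z_1\mathcal{P}_{n-1,m-1}$ (dimension $m$). Let $\vec E_1\in\mathbb{C}^n[z_1,z_2]$, $\vec E_2\in\mathbb{C}^m[z_1,z_2]$ be column vector polynomials whose entries form orthonormal bases of $\mathcal{E}_1,\mathcal{E}_2$,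 and write $\vec E_1(z)=E_1(z_2)\Lambda_n(z_1)$, $\vec E_2(z)=E_2(z_1)\Lambda_m(z_2)$ with matrix polynomials $E_1\in\mathbb{C}^{n\times n}[z_2]$, $E_2\in\mathbb{C}^{m\times m}[z_1]$, where $\Lambda_N(x)=(1,x,\dots,x^{N-1})^t$. If a one-variable polynomial factors as $g_1g_2$ with $g_1$ having no zeros on $\mathbb{T}$ and $g_2$ having all its zeros on $\mathbb{T}$, then $g_2$ (unique up to a constant) is its $\mathbb{T}$-factor. *)

(* Defs.v *)
From HB Require Import structures.
From mathcomp Require Import all_boot all_order all_algebra.
From mathcomp Require Import all_classical all_reals all_analysis.
From mathcomp Require Import complex.
Set Implicit Arguments. Unset Strict Implicit. Unset Printing Implicit Defensive.
Import Order.TTheory GRing.Theory Num.Theory.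
Local Open Scope ring_scope.

Section Defs.
Variable R : realType.
Local Notation C := R[i].

(* Bivariate polynomials: P : {poly {poly C}}; the OUTER variable is z2, the
   coefficients are polynomials in z1.  So P = \sum_k P`_k(z1) z2^k. *)
Definition eval2 (P : {poly {poly C}}) (z1 z2 : C) : C := (P.[z2%:P]).[z1].

Definition degX (P : {poly {poly C}}) : nat := (\max_(i < size P) (size (P`_i)%R).-1)%N.
Definition degY (P : {poly {poly C}}) : nat := (size P).-1.
Definition bidegree (P : {poly {poly C}}) (n m : nat) : Prop :=
  degX P = n /\ degY P = m.

(* [sizes_le P a b] : P has degree < a in z1 and degree < b in z2, i.e.
   bidegree at most (a-1, b-1) (with bidegree at most (-1, _) meaning P = 0) *)
Definition sizes_le (P : {poly {poly C}}) (a b : nat) : Prop :=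
  (size P <= b)%N /\ (forall i : nat, (size (P`_i)%R <= a)%N).

(* p~(z) = z1^n z2^m conj(p(1/conj z1, 1/conj z2)), written on coefficients *)
Definition reflect2 (n m : nat) (P : {poly {poly C}}) : {poly {poly C}} :=
  \poly_(k < m.+1) \poly_(j < n.+1) ((P`_(m - k))`_(n - j))^*.

Definition no_zeros_bidisk (P : {poly {poly C}}) : Prop :=
  forall z1 z2 : C, `|z1| < 1 -> `|z2| < 1 -> eval2 P z1 z2 != 0.

Definition divides2 (r P : {poly {poly C}}) : Prop := exists s, P = s * r.

Definition semi_stable (n m : nat) (P : {poly {poly C}}) : Prop :=
  [/\ bidegree P n m, no_zeros_bidisk P &
      ~ (exists r, r \isn't a GRing.unit /\ divides2 r P /\ divides2 r (reflect2 n m P))].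

(* ---------- analysis on T^2, parametrized by [0,1]^2 via t |-> e^{2 pi i t} *)
Definition expi (t : R) : C := Complex (cos (2 * pi * t)) (sin (2 * pi * t)).
Definition cabs2 (z : C) : R := complex.Re z ^+ 2 + complex.Im z ^+ 2.
Definition torus (P : {poly {poly C}}) (x : R * R) : C := eval2 P (expi x.1) (expi x.2).
Definition sq01 : set (R * R) := (`[0, 1] `*` `[0, 1])%classic.
(* normalized Lebesgue measure sigma on T^2 (pulled back to [0,1]^2) *)
Definition mu2 := ((@lebesgue_measure R) \x (@lebesgue_measure R))%E.

Definition in_Ip (p q : {poly {poly C}}) : Prop :=
  (\int[mu2]_(x in sq01) (cabs2 (torus q x) / cabs2 (torus p x))%:E < +oo)%E.

Definition in_Ipinf (p q : {poly {poly C}}) : Prop :=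
  exists M : R, {ae mu2, forall x, sq01 x -> cabs2 (torus q x) / cabs2 (torus p x) <= M}.

Definition wip (p f g : {poly {poly C}}) : C :=
  let h x := torus f x * (torus g x)^* / real_complex R (cabs2 (torus p x)) in
  Complex (Rintegral mu2 sq01 (fun x => complex.Re (h x)))
          (Rintegral mu2 sq01 (fun x => complex.Im (h x))).

Definition Pspace (p : {poly {poly C}}) (a b : nat) (f : {poly {poly C}}) : Prop :=
  sizes_le f a b /\ in_Ip p f.

Definition E1space (n m : nat) (p f : {poly {poly C}}) : Prop :=
  Pspace p n m.+1 f /\ (forall g, Pspace p n m g -> wip p f ('X * g) = 0).

Definition E2space (n m : nat) (p f : {poly {poly C}}) : Prop :=
  Pspace p n.+1 m f /\ (forall g, Pspace p n m g -> wip p f ('X%:P * g) = 0).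

Definition onb (p : {poly {poly C}}) (S : {poly {poly C}} -> Prop) (N : nat)
    (e : 'I_N -> {poly {poly C}}) : Prop :=
  [/\ forall i, S (e i),
      forall i j, wip p (e i) (e j) = (i == j)%:R &
      forall f, S f -> exists c : 'I_N -> C, f = \sum_i (c i)%:P%:P * e i].

(* vec E1(z) = E1(z2) Lambda_N(z1):  E1[i,k](z2) = coefficient of z1^k in e_i *)
Definition E1mat (N : nat) (e : 'I_N -> {poly {poly C}}) : 'M[{poly C}]_N :=
  \matrix_(i, k) \poly_(l < size (e i)) ((e i)`_l)`_k.
(* vec E2(z) = E2(z1) Lambda_N(z2):  E2[i,k](z1) = coefficient of z2^k in e_i *)
Definition E2mat (N : nat) (e : 'I_N -> {poly {poly C}}) : 'M[{poly C}]_N :=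
  \matrix_(i, k) (e i)`_k.

Definition T_factor (f g : {poly C}) : Prop :=
  exists g1, [/\ f = g1 * g, (forall x, root g1 x -> `|x| != 1) &
                 (forall x, root g x -> `|x| = 1)].

End Defs.

(* Main.v *)
(* On the torus write w for the variable of a one-variable polynomial f and z for the
   other one.  The heart is the estimate |f(w)|^2 <= K |p(w,z)| whenever f/p is square
   integrable.  For the mean J(w) of 1/|p(w,.)|^2 over the circle, a Lipschitz bound on p
   gives 1 <= K J(w) |p(w,z)|.  Eliminating z between p and its reflection, r = u p + v q,
   and using that p(w,.) has no zeros in the closed disk for generic w, Cauchy's theorem
   shows that J agrees on the circle with a rational function.  Hence |f|^2 J is the
   modulus of an integrable rational function on the circle, which cannot have poles there
   and is bounded.  The determinant of E_1 is a combination of the entries of vec E_1, so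
   it lies in I_p, and so does its T-factor g; likewise for h.  The two estimates multiply
   to |g h| <= K |p|. *)
Require Import Defs.
From HB Require Import structures.
From mathcomp Require Import all_boot all_order all_algebra.
From mathcomp Require Import all_classical all_reals all_analysis.
From mathcomp Require Import measurable_realfun complex ring lra.
Import Order.TTheory GRing.Theory Num.Theory.
Import numFieldNormedType.Exports.
Set Implicit Arguments. Unset Strict Implicit. Unset Printing Implicit Defensive.
Local Open Scope classical_set_scope.
Local Open Scope ring_scope.

(** * The modulus of a complex number as a real number *)

Section Modulus.
Variable R : realType.
Local Notation C := R[i].
Implicit Types (z w : C) (x : R).

(** The exponent 2 on f comes from the size of J: if |p(w,z)| = d is small, |p(w,.)| is at most 2d
    on an arc of length proportional to d, so J is at least of order d/d^2 = 1/d. Each variable thus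
    contributes half a power of |p|, and the two halves make the whole. The obstacle is that J is a
    real integral with no evident analyticity in w. Elimination supplies it, and needs p(w,.) and
    its reflection to be free of common zeros for generic w. This is drawn from integrability
    itself: for almost every w the inner integral of |f/p|^2 is finite, which forbids zeros of
    p(w,.) on the circle; zeros inside the disk are excluded by passing to the limit from the
    bidisk, and a zero outside would be shared only if its mirror image inside were a zero too.
    Rationality holds only off finitely many w, so the estimates carry a polynomial whose zeros are
    exempted; they form a null set of the torus. Bounds are written as products |T| <= B |S| because
    a quotient by zero is 0 and would hide the zeros of S. *)

Definition cmod z : R := complex.Re `|z|.

Lemma cmodE z : `|z| = real_complex R (cmod z).
Proof. by rewrite /cmod normc_def. Qed.

Lemma cmod_sqrt z : cmod z = Num.sqrt (cabs2 z).
Proof. by rewrite /cmod normc_def. Qed.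

Lemma cabs2_ge0 z : 0 <= cabs2 z.
Proof. by rewrite addr_ge0 ?sqr_ge0. Qed.

Lemma cabs2E z : cabs2 z = cmod z ^+ 2.
Proof. by rewrite cmod_sqrt sqr_sqrtr ?cabs2_ge0. Qed.

Lemma cmod_ge0 z : 0 <= cmod z.
Proof. by rewrite cmod_sqrt sqrtr_ge0. Qed.

Lemma cmodM z w : cmod (z * w) = cmod z * cmod w.
Proof. by apply: (@complexI R); rewrite rmorphM/= -!cmodE normrM. Qed.

Lemma cmod1 : cmod 1 = 1 :> R.
Proof. by rewrite /cmod normr1. Qed.

Lemma cmod0 : cmod 0 = 0 :> R.
Proof. by rewrite /cmod normr0. Qed.

Lemma cmodX z n : cmod (z ^+ n) = cmod z ^+ n.
Proof. by elim: n => [|n IH]; rewrite ?expr0 ?cmod1// !exprS cmodM IH. Qed.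

Lemma cmodV z : cmod z^-1 = (cmod z)^-1.
Proof.
apply: (@complexI R); rewrite -cmodE normfV cmodE.
by rewrite fmorphV.
Qed.

Lemma cmod_eq0 z : (cmod z == 0) = (z == 0).
Proof.
by rewrite -[RHS]normr_eq0 cmodE -[0 in RHS](rmorph0 (real_complex R)) (inj_eq (@complexI R)).
Qed.

Lemma cmod_gt0 z : (0 < cmod z) = (z != 0).
Proof. by rewrite lt_def cmod_ge0 andbT cmod_eq0. Qed.

Lemma cmodD z w : cmod (z + w) <= cmod z + cmod w.
Proof. by rewrite -lecR rmorphD/= -!cmodE ler_normD. Qed.

Lemma cmodN z : cmod (- z) = cmod z.
Proof. by rewrite /cmod normrN. Qed.

Lemma cmodB z w : cmod z - cmod w <= cmod (z - w).
Proof. by rewrite lerBlDr; apply: le_trans (cmodD _ _); rewrite subrK. Qed.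

Lemma cmodC z : cmod (conjc z) = cmod z.
Proof. by case: z => a b; rewrite !cmod_sqrt /cabs2 /= sqrrN. Qed.

Lemma cmod_real x : cmod (real_complex R x) = `|x|.
Proof. by rewrite cmod_sqrt /cabs2/= expr0n/= addr0 sqrtr_sqr. Qed.

Lemma cmod_Re z : `|complex.Re z| <= cmod z.
Proof.
rewrite cmod_sqrt -sqrtr_sqr ler_wsqrtr// /cabs2.
by rewrite lerDl sqr_ge0.
Qed.

Lemma cmod_Im z : `|complex.Im z| <= cmod z.
Proof.
rewrite cmod_sqrt -sqrtr_sqr ler_wsqrtr// /cabs2.
by rewrite lerDr sqr_ge0.
Qed.

Lemma cmod_le_ReIm z : cmod z <= `|complex.Re z| + `|complex.Im z|.
Proof.
rewrite -(ler_pXn2r (n := 2)) ?nnegrE ?addr_ge0 ?cmod_ge0//.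
rewrite -cabs2E /cabs2 -[complex.Re z ^+ 2]real_normK ?num_real//.
rewrite -[complex.Im z ^+ 2]real_normK ?num_real//.
have := normr_ge0 (complex.Re z); have := normr_ge0 (complex.Im z); nra.
Qed.

Lemma conjcM z w : conjc (z * w) = conjc z * conjc w.
Proof. exact: rmorphM. Qed.

Lemma conjcX z n : conjc (z ^+ n) = conjc z ^+ n.
Proof. exact: rmorphXn. Qed.

Lemma mulr_conjc z : z * conjc z = real_complex R (cabs2 z).
Proof. by case: z => a b; rewrite /cabs2 /=; simpc; congr Complex; ring. Qed.

Lemma conjc_unit z : cmod z = 1 -> conjc z = z^-1.
Proof.
move=> z1; have z0 : z != 0 by rewrite -cmod_gt0 z1 ltr01.
apply: (mulfI z0); rewrite mulr_conjc mulfV// cabs2E z1 expr1n.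
by [].
Qed.

Lemma cmod_lt1 z : (`|z| < 1) = (cmod z < 1).
Proof. by rewrite cmodE -ltcR. Qed.

End Modulus.

(** * The parametrization of the unit circle *)

Section Expi.
Variable R : realType.
Local Notation C := R[i].
Implicit Types s t : R.

Lemma cmod_expi t : cmod (expi t) = 1.
Proof. by rewrite cmod_sqrt /cabs2 /= cos2Dsin2 sqrtr1. Qed.

Lemma expi_neq0 t : expi t != 0.
Proof. by rewrite -cmod_gt0 cmod_expi. Qed.

Lemma expiD s t : expi (s + t) = expi s * expi t.
Proof.
rewrite /expi mulrDr cosD sinD; simpc; congr Complex; ring.
Qed.

Lemma expi0 : expi 0 = 1 :> C.
Proof. by rewrite /expi mulr0 cos0 sin0. Qed.

Lemma expiX t k : expi t ^+ k = expi (k%:R * t).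
Proof.
elim: k => [|k IH]; first by rewrite expr0 mul0r expi0.
by rewrite exprS IH -expiD -natr1 mulrDl mul1r addrC.
Qed.

Lemma expiN t : expi (- t) = conjc (expi t).
Proof. by rewrite /expi mulrN cosN sinN. Qed.

(** The cosine is injective only on [0, pi]: a parameter beyond 1/2 is reflected to
    [2 * pi - 2 * pi * t], and the outcome t = 1 is excluded by the range. *)
Lemma expi_eq1 t : 0 <= t < 1 -> expi t = 1 -> t = 0.
Proof.
move=> /andP[t0 t1] [c1 _].
have pi0 := pi_gt0 R.
have [tle|tgt] := leP t (2^-1).
  have : 2 * pi * t = 0.
    apply: cos_inj; rewrite ?in_itv/= ?lexx ?pi_ge0 ?cos0//.
    by rewrite !mulr_ge0 ?pi_ge0//=; nra.
  by move/eqP; rewrite mulf_eq0 mulf_eq0 pnatr_eq0/= gt_eqF//= => /eqP.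
have : 2 * pi - 2 * pi * t = 0.
  apply: cos_inj; rewrite ?in_itv/= ?lexx ?pi_ge0 ?cos0//.
    by apply/andP; split; nra.
  by rewrite mulr_natl cosB cos2pi sin2pi mul1r mul0r addr0 -mulr_natl c1.
nra.
Qed.

Lemma expi_inj s t : 0 <= s < 1 -> 0 <= t < 1 -> expi s = expi t -> s = t.
Proof.
wlog st : s t / s <= t.
  move=> H hs ht e; have [|] := leP s t => [|/ltW] h; first exact: H.
  by apply/esym/H.
move=> /andP[s0 s1] /andP[t0 t1] e; apply/eqP; rewrite eq_sym -subr_eq0; apply/eqP.
apply: expi_eq1; first by apply/andP; split; lra.
by rewrite expiD expiN -e mulr_conjc cabs2E cmod_expi expr1n.
Qed.

(** By the mean value theorem the cosine and the sine are 1-Lipschitz; each contributes [2 * pi] to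
    the constant. *)
Lemma expi_lip s t : cmod (expi s - expi t) <= 4 * pi * `|s - t|.
Proof.
have lip (f df : R -> R) : (forall x, is_derive (x : R) (1 : R) f (df x)) ->
    (forall x, `|df x| <= 1) -> forall x y, `|f x - f y| <= `|x - y|.
  move=> dfE df1 x y; wlog xy : x y / y <= x.
    by move=> H; have [|/ltW] := leP y x => h; [|rewrite distrC [leRHS]distrC]; exact: H.
  have [c _ ->] := @MVT_segment R f df y x xy (fun x _ => dfE x)
    (derivable_within_continuous (fun x _ => @ex_derive _ _ _ _ _ _ _ (dfE x))).
  by rewrite normrM ler_piMl.
have e u v : `|2 * pi * u - 2 * pi * v| = 2 * pi * `|u - v|.
  by rewrite -mulrBr normrM ger0_norm// mulr_ge0// pi_ge0.
apply: (le_trans (cmod_le_ReIm _)); rewrite /=.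
have : `|cos (2 * pi * s) - cos (2 * pi * t)| <= `|2 * pi * s - 2 * pi * t|.
  apply: (lip _ (fun x => - sin x)) => x; rewrite normrN ler_norml.
  by rewrite sin_geN1 sin_le1.
have : `|sin (2 * pi * s) - sin (2 * pi * t)| <= `|2 * pi * s - 2 * pi * t|.
  by apply: (lip _ (fun x => cos x)) => x; rewrite ler_norml cos_geN1 cos_le1.
rewrite e; lra.
Qed.

Lemma continuous_Re_expi : continuous (fun t : R => complex.Re (expi t)).
Proof.
move=> t; apply: continuous_comp; last exact: continuous_cos.
by apply: mulrl_continuous.
Qed.

Lemma continuous_Im_expi : continuous (fun t : R => complex.Im (expi t)).
Proof.
move=> t; apply: continuous_comp; last exact: continuous_sin.
by apply: mulrl_continuous.
Qed.

End Expi.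

(** * Polynomials on the closed disk, reflection in the circle, rational functions on the circle *)

Section PolyDisk.
Variable R : realType.
Local Notation C := R[i].
Implicit Types (P Q : {poly C}) (p : {poly {poly C}}) (z w : C).

Lemma poly_bounded P : exists B, forall z, cmod z <= 1 -> cmod P.[z] <= B.
Proof.
elim/poly_ind: P => [|P c [B hB]]; first by exists 0 => z _; rewrite horner0 cmod0.
exists (B + cmod c) => z z1; rewrite hornerMXaddC (le_trans (cmodD _ _))// lerD2r cmodM.
have := hB z z1; have := cmod_ge0 P.[z]; have := cmod_ge0 z; nra.
Qed.

Lemma poly_lipschitz P : exists2 L, 0 <= L & forall z w, cmod z <= 1 -> cmod w <= 1 ->
  cmod (P.[z] - P.[w]) <= L * cmod (z - w).
Proof.
elim/poly_ind: P => [|P c [L L0 hL]].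
  by exists 0 => // z w _ _; rewrite !horner0 subrr cmod0 mul0r.
have [B hB] := poly_bounded P.
exists (L + `|B|) => [|z w z1 w1]; first by rewrite addr_ge0.
rewrite !hornerMXaddC.
have -> : P.[z] * z + c - (P.[w] * w + c) = (P.[z] - P.[w]) * z + P.[w] * (z - w) by ring.
rewrite (le_trans (cmodD _ _))// !cmodM mulrDl lerD//.
  have := hL z w z1 w1; have := cmod_ge0 (P.[z] - P.[w]); have := cmod_ge0 z; nra.
by rewrite ler_wpM2r ?cmod_ge0// (le_trans (hB _ w1))// ler_norm.
Qed.

Definition slice p w : {poly C} := map_poly (horner_eval w) p.

Lemma horner_slice p w z : (slice p w).[z] = eval2 p w z.
Proof.
by rewrite /slice /eval2 -[z in LHS](hornerC z w) -[(z%:P).[w]]/(horner_eval w z%:P) horner_map.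
Qed.

Lemma eval2_MXaddC p (c : {poly C}) w z :
  eval2 (p * 'X + c%:P) w z = eval2 p w z * z + c.[w].
Proof. by rewrite /eval2 hornerMXaddC hornerD hornerM hornerC. Qed.

Lemma eval2_0 w z : eval2 (0 : {poly {poly C}}) w z = 0.
Proof. by rewrite /eval2 !horner0. Qed.

Lemma eval2D p (q : {poly {poly C}}) w z : eval2 (p + q) w z = eval2 p w z + eval2 q w z.
Proof. by rewrite /eval2 !hornerD. Qed.

Lemma eval2M p (q : {poly {poly C}}) w z : eval2 (p * q) w z = eval2 p w z * eval2 q w z.
Proof. by rewrite /eval2 !hornerM. Qed.

Lemma eval2C (c : {poly C}) w z : eval2 c%:P w z = c.[w].
Proof. by rewrite /eval2 hornerC. Qed.

Lemma eval2_map (c : {poly C}) w z : eval2 (c^:P) w z = c.[z].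
Proof. by rewrite /eval2 horner_map hornerC. Qed.

Lemma eval2_swap p w z : eval2 (swapXY p) w z = eval2 p z w.
Proof. by rewrite /eval2 horner2_swapXY. Qed.

Lemma eval2_bounded p : exists B, forall w z, cmod w <= 1 -> cmod z <= 1 -> cmod (eval2 p w z) <= B.
Proof.
elim/poly_ind: p => [|p c [B hB]]; first by exists 0 => w z _ _; rewrite eval2_0 cmod0.
have [D hD] := poly_bounded c.
exists (B + D) => w z w1 z1; rewrite eval2_MXaddC (le_trans (cmodD _ _))// lerD ?hD// cmodM.
have := hB w z w1 z1; have := cmod_ge0 (eval2 p w z); have := cmod_ge0 z; nra.
Qed.

Lemma eval2_lipschitz p : exists2 L, 0 <= L & forall w z z', cmod w <= 1 -> cmod z <= 1 ->
  cmod z' <= 1 -> cmod (eval2 p w z - eval2 p w z') <= L * cmod (z - z').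
Proof.
elim/poly_ind: p => [|p c [L L0 hL]].
  by exists 0 => // w z z' _ _ _; rewrite !eval2_0 subrr cmod0 mul0r.
have [B hB] := eval2_bounded p.
exists (L + `|B|) => [|w z z' w1 z1 z1']; first by rewrite addr_ge0.
rewrite !eval2_MXaddC.
set a := eval2 p w z; set b := eval2 p w z'.
have -> : a * z + c.[w] - (b * z' + c.[w]) = (a - b) * z + b * (z - z') by ring.
rewrite (le_trans (cmodD _ _))// !cmodM mulrDl lerD//.
  have := hL w z z' w1 z1 z1'; rewrite -/a -/b; have := cmod_ge0 (a - b); have := cmod_ge0 z; nra.
by rewrite ler_wpM2r ?cmod_ge0// (le_trans (hB _ _ w1 z1'))// ler_norm.
Qed.

Lemma poly_reflect P : exists P' d, forall w, cmod w = 1 ->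
  P'.[w] = w ^+ d * conjc P.[w].
Proof.
elim/poly_ind: P => [|P c [P' [d hP]]].
  by exists 0, 0%N => w _; rewrite !horner0 conjc0 mulr0.
exists (P' + (conjc c)%:P * 'X^(d.+1)), d.+1 => w w1.
rewrite hornerMXaddC rmorphD rmorphM/= hornerD hornerM hornerC hornerXn hP//.
have w0 : w != 0 by rewrite -cmod_gt0 w1.
by rewrite (conjc_unit w1) exprS; field.
Qed.

(** The identity covers every nonzero z, not only the circle, because zeros outside the disk are
    later carried inside by z -> 1 / conj z. The exponents are those that Horner's recursion
    produces. *)
Lemma eval2_reflect p : exists p' d e, forall w z, cmod w = 1 -> z != 0 ->
  eval2 p' w z = z ^+ d * w ^+ e * conjc (eval2 p w (conjc z)^-1).
Proof.
elim/poly_ind: p => [|p c [p' [d [e hp]]]].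
  by exists 0, 0%N, 0%N => w z _ _; rewrite !eval2_0 conjc0 mulr0.
have [c' [e' hc]] := poly_reflect c.
exists (('X^e')%:P * p' + ('X^e * c')%:P * 'X^(d.+1)), d.+1, (e + e')%N => w z w1 z0.
rewrite eval2_MXaddC rmorphD rmorphM/= eval2D !eval2M !eval2C hp// hc//.
rewrite [eval2 'X^(d.+1) w z]/eval2 !hornerXn -rmorphXn/= hornerC.
by rewrite !rmorphM/= conjc_inv conjcK exprD exprS; field.
Qed.

Lemma eval2_reflect_torus p p' d e : (forall w z, cmod w = 1 -> z != 0 ->
  eval2 p' w z = z ^+ d * w ^+ e * conjc (eval2 p w (conjc z)^-1)) ->
  forall w z, cmod w = 1 -> cmod z = 1 ->
  eval2 p' w z = z ^+ d * w ^+ e * conjc (eval2 p w z).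
Proof.
move=> h w z w1 z1; have z0 : z != 0 by rewrite -cmod_gt0 z1.
by rewrite h// (conjc_unit z1) invrK.
Qed.

(** Equality is asked only off the zeros of [S], so that finitely many exceptional points can always
    be absorbed into the denominator. *)
Definition rational_on_circle (F : C -> C) := exists T S : {poly C}, S != 0 /\
  forall w, cmod w = 1 -> S.[w] != 0 -> F w = T.[w] / S.[w].

Lemma rational_ext (Q : {poly C}) (F G : C -> C) : Q != 0 ->
  (forall w, cmod w = 1 -> Q.[w] != 0 -> G w = F w) ->
  rational_on_circle F -> rational_on_circle G.
Proof.
move=> Q0 h [T [S [S0 hF]]]; exists (T * Q), (S * Q); split; first by rewrite mulf_neq0.
move=> w w1; rewrite !hornerM mulf_eq0 negb_or => /andP[s0 q0].
by rewrite h// hF//; field; apply/andP.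
Qed.

Lemma rational_poly P : rational_on_circle (fun w => P.[w]).
Proof. by exists P, 1; rewrite oner_neq0; split => // w _ _; rewrite hornerC divr1. Qed.

Lemma rationalM F G : rational_on_circle F -> rational_on_circle G ->
  rational_on_circle (fun w => F w * G w).
Proof.
move=> [T [S [S0 hF]]] [T' [S' [S0' hG]]].
exists (T * T'), (S * S'); split; first by rewrite mulf_neq0.
move=> w w1; rewrite !(hornerD, hornerM) mulf_eq0 negb_or => /andP[s0 s0'].
by rewrite hF// hG//; field; apply/andP.
Qed.

Lemma rational_div F P : P != 0 -> rational_on_circle F ->
  rational_on_circle (fun w => F w / P.[w]).
Proof.
move=> P0 hF; apply: rationalM hF _; exists 1, P; split => // w _ _.
by rewrite hornerC mul1r.
Qed.

(** On the circle the conjugate of a polynomial is its reflection divided by a power of w. What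
    needs an argument is that the reflected denominator is not the zero polynomial. *)
Lemma rational_conj F : rational_on_circle F -> rational_on_circle (fun w => conjc (F w)).
Proof.
move=> [T [S [S0 hF]]]; have [T' [d hT]] := poly_reflect T; have [S' [e hS]] := poly_reflect S.
(* conj T / conj S = (T' w^-d) / (S' w^-e); the common factor [S] puts the zeros of [S] into the
   exceptional set. *)
exists (T' * 'X^e * S), (S' * 'X^d * S); split.
  apply/negP; rewrite !mulf_eq0 (negPf S0) !orbF => /orP[/eqP S'0|]; last first.
    by rewrite expf_eq0 polyX_eq0 andbF.
  (* If [S'] were zero, [S] would vanish at [size S] distinct points of the circle, one more than
     its degree allows. *)
  have /negP[] := S0; apply/eqP/(@roots_geq_poly_eq0 _ _
    [seq expi (i%:R / (size S).+1%:R) | i <- iota 0 (size S)]).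
  - apply/allP => _ /mapP[i _ ->]; set w := expi _.
    have /eqP := hS w (cmod_expi _); rewrite S'0 horner0 eq_sym mulf_eq0 conjc_eq0.
    by rewrite expf_eq0 (negPf (expi_neq0 _)) andbF.
  - rewrite map_inj_in_uniq ?iota_uniq// => i j; rewrite !mem_iota /= !add0n => hi hj.
    have lt1 k : (k < size S)%N -> 0 <= (k%:R / (size S).+1%:R : R) < 1.
      by move=> hk; rewrite divr_ge0// ltr_pdivrMr// mul1r ltr_nat ltnS ltnW.
    move=> /(expi_inj (lt1 _ hi) (lt1 _ hj))/(mulIf _) /eqP.
    by rewrite eqr_nat => h; apply/eqP; apply: h; rewrite invr_eq0.
  - by rewrite size_map size_iota.
move=> w w1; have w0 : w != 0 by rewrite -cmod_gt0 w1.
rewrite !hornerM !mulf_eq0 !negb_or => /andP[/andP[s0' _] s0].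
rewrite hF// hT// !hornerXn hS// rmorphM/= conjc_inv.
have cs0 : conjc S.[w] != 0 by rewrite conjc_eq0.
by field; rewrite s0 cs0 !expf_neq0.
Qed.

End PolyDisk.

(** * Continuity of complex functions of a real parameter *)

Section ContinuousC.
Variable R : realType.
Local Notation C := R[i].
Implicit Types (F G : R -> C) (P : {poly C}).

(** Continuity by components matches the integrals below, which are taken on real and imaginary
    parts separately. *)
Definition ccontinuous F := continuous (fun t => complex.Re (F t)) /\
  continuous (fun t => complex.Im (F t)).

Lemma Re_mul (z w : C) : complex.Re (z * w) =
  complex.Re z * complex.Re w - complex.Im z * complex.Im w.
Proof. by case: z => a b; case: w => c d. Qed.

Lemma Im_mul (z w : C) : complex.Im (z * w) =
  complex.Re z * complex.Im w + complex.Im z * complex.Re w.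
Proof. by case: z => a b; case: w => c d. Qed.

Lemma ccontinuous_cst (c : C) : ccontinuous (fun=> c).
Proof. by split => t; exact: cvg_cst. Qed.

Lemma ccontinuousD F G : ccontinuous F -> ccontinuous G ->
  ccontinuous (fun t => F t + G t).
Proof.
move=> [F1 F2] [G1 G2]; split => t.
- under eq_fun do rewrite raddfD/=.
  by apply: cvgD; [exact: F1|exact: G1].
- under eq_fun do rewrite raddfD/=.
  by apply: cvgD; [exact: F2|exact: G2].
Qed.

Lemma ccontinuousM F G : ccontinuous F -> ccontinuous G ->
  ccontinuous (fun t => F t * G t).
Proof.
move=> [F1 F2] [G1 G2]; split => t.
- under eq_fun do rewrite Re_mul/=.
  by apply: cvgB; apply: cvgM; [exact: F1|exact: G1|exact: F2|exact: G2].
- under eq_fun do rewrite Im_mul/=.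
  by apply: cvgD; apply: cvgM; [exact: F1|exact: G2|exact: F2|exact: G1].
Qed.

Lemma ccontinuous_conj F : ccontinuous F -> ccontinuous (fun t => conjc (F t)).
Proof.
have ReC (z : C) : complex.Re (conjc z) = complex.Re z by case: z.
have ImC (z : C) : complex.Im (conjc z) = - complex.Im z by case: z.
move=> [F1 F2]; split => t.
- by under eq_fun do rewrite ReC; exact: F1.
- by under eq_fun do rewrite ImC; apply: cvgN; exact: F2.
Qed.

Lemma continuous_cabs2 F : ccontinuous F -> continuous (fun t => cabs2 (F t)).
Proof.
by move=> [F1 F2] t; apply: cvgD; apply: cvgM; [exact: F1|exact: F1|exact: F2|exact: F2].
Qed.

Lemma continuous_cmod F : ccontinuous F -> continuous (fun t => cmod (F t)).
Proof.
move=> cF t; under eq_fun do rewrite cmod_sqrt.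
by apply: continuous_comp; [exact: continuous_cabs2|exact: sqrt_continuous].
Qed.

Lemma ccontinuous_real (f : R -> R) : continuous f -> ccontinuous (fun t => real_complex R (f t)).
Proof. by move=> cf; split => t /=; [exact: cf|exact: cvg_cst]. Qed.

Lemma ccontinuousV F : (forall t, F t != 0) -> ccontinuous F -> ccontinuous (fun t => (F t)^-1).
Proof.
move=> F0 cF; have -> : (fun t => (F t)^-1) = (fun t => conjc (F t) * real_complex R ((cabs2 (F t))^-1)).
  apply/funext => t; apply: (mulfI (F0 t)); rewrite mulfV//.
  rewrite mulrA mulr_conjc -rmorphM/= divff// cabs2E expf_neq0// cmod_eq0.
  exact: F0.
apply: ccontinuousM; first exact: ccontinuous_conj.
apply: ccontinuous_real => t; apply: cvgV; last exact: continuous_cabs2.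
by rewrite cabs2E expf_neq0// cmod_eq0.
Qed.

Lemma ccontinuous_poly P F : ccontinuous F -> ccontinuous (fun t => P.[F t]).
Proof.
move=> cF; elim/poly_ind: P => [|P c IH].
  by under eq_fun do rewrite horner0; exact: ccontinuous_cst.
under eq_fun do rewrite hornerMXaddC.
by apply: ccontinuousD; [exact: ccontinuousM|exact: ccontinuous_cst].
Qed.

Lemma ccontinuous_expi : ccontinuous (@expi R).
Proof. by split; [exact: continuous_Re_expi|exact: continuous_Im_expi]. Qed.

End ContinuousC.

(** * Measurability of complex functions *)

Section MeasurableC.
Variables (R : realType) (d : measure_display) (T : measurableType d).
Local Notation C := R[i].
Implicit Types (F G : T -> C) (P : {poly C}) (p : {poly {poly C}}).

Definition cmeasurable F := measurable_fun setT (fun t => complex.Re (F t)) /\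
  measurable_fun setT (fun t => complex.Im (F t)).

Lemma cmeasurable_cst (c : C) : cmeasurable (fun=> c).
Proof. by split; exact: measurable_cst. Qed.

Lemma cmeasurableD F G : cmeasurable F -> cmeasurable G -> cmeasurable (fun t => F t + G t).
Proof.
move=> [F1 F2] [G1 G2]; split; under eq_fun do rewrite raddfD/=; exact: measurable_funD.
Qed.

Lemma cmeasurableM F G : cmeasurable F -> cmeasurable G -> cmeasurable (fun t => F t * G t).
Proof.
move=> [F1 F2] [G1 G2]; split.
- under eq_fun do rewrite Re_mul.
  by apply: measurable_funB; exact: measurable_funM.
- under eq_fun do rewrite Im_mul.
  by apply: measurable_funD; exact: measurable_funM.
Qed.

Lemma cmeasurable_poly P F : cmeasurable F -> cmeasurable (fun t => P.[F t]).
Proof.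
move=> cF; elim/poly_ind: P => [|P c IH].
  by under eq_fun do rewrite horner0; exact: cmeasurable_cst.
under eq_fun do rewrite hornerMXaddC.
by apply: cmeasurableD; [exact: cmeasurableM|exact: cmeasurable_cst].
Qed.

Lemma cmeasurable_eval2 p F G : cmeasurable F -> cmeasurable G ->
  cmeasurable (fun t => eval2 p (F t) (G t)).
Proof.
move=> cF cG; elim/poly_ind: p => [|p c IH].
  by under eq_fun do rewrite eval2_0; exact: cmeasurable_cst.
under eq_fun do rewrite eval2_MXaddC.
by apply: cmeasurableD; [exact: cmeasurableM|exact: cmeasurable_poly].
Qed.

Lemma measurable_cabs2 F : cmeasurable F -> measurable_fun setT (fun t => cabs2 (F t)).
Proof. by move=> [F1 F2]; apply: measurable_funD; exact: measurable_funX. Qed.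

(** On nonnegative reals inversion is the real power -1, which also sends 0 to 0, and real powers
    are measurable. *)
Lemma measurable_ge0_inv (f : T -> R) : (forall t, 0 <= f t) ->
  measurable_fun setT f -> measurable_fun setT (fun t => (f t)^-1).
Proof.
move=> f0 mf; under eq_fun do rewrite -powR_inv1//.
exact: (measurableT_comp (measurable_powR _) mf).
Qed.

Lemma measurable_cabs2_ratio F G : cmeasurable F -> cmeasurable G ->
  measurable_fun setT (fun t => (cabs2 (F t) / cabs2 (G t))%:E).
Proof.
move=> mF mG; apply/measurable_EFinP; apply: measurable_funM; first exact: measurable_cabs2.
by apply: (measurable_ge0_inv (fun t => cabs2_ge0 (G t))); exact: measurable_cabs2.
Qed.

Lemma cmeasurable_expi (f : T -> R) : measurable_fun setT f -> cmeasurable (fun t => expi (f t)).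
Proof.
move=> mf; split.
- exact: (measurableT_comp (continuous_measurable_fun (@continuous_Re_expi R)) mf).
- exact: (measurableT_comp (continuous_measurable_fun (@continuous_Im_expi R)) mf).
Qed.

End MeasurableC.

(** * Null sets on the circle, and integrable rational functions *)

Section CircleAE.
Variable R : realType.
Local Notation C := R[i].
Local Notation mu := (@lebesgue_measure R).
Implicit Types (P S T : {poly C}) (t x : R).

(** A polynomial has finitely many roots, and each is attained at most once for parameters below 1;
    the endpoint 1 is added separately. *)
Lemma circle_zeros_finite S : S != 0 ->
  finite_set [set t : R | 0 <= t <= 1 /\ S.[expi t] = 0].
Proof.
move=> S0; have [rs hrs] := closed_field_poly_normal S.
have fin1 (z : C) : finite_set [set t : R | 0 <= t < 1 /\ expi t = z].
  have [[t [t01 <-]]|no] := pselect (exists t, 0 <= t < 1 /\ expi t = z).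
    apply: (@sub_finite_set _ _ [set t]); last exact: finite_set1.
    by move=> s [s01 st]; apply: expi_inj.
  by apply: (@sub_finite_set _ _ set0) => // t ht; apply: no; exists t.
have fins : finite_set [set t : R | 0 <= t < 1 /\ expi t \in rs].
  elim: rs {hrs} => [|z rs IH].
    by apply: (@sub_finite_set _ _ set0) => // t [].
  apply: (@sub_finite_set _ _ ([set t : R | 0 <= t < 1 /\ expi t = z] `|`
      [set t : R | 0 <= t < 1 /\ expi t \in rs])).
    by move=> t [t01]; rewrite inE => /predU1P[|] h; [left|right].
  by rewrite finite_setU.
apply: (@sub_finite_set _ _ ([set 1] `|` [set t : R | 0 <= t < 1 /\ expi t \in rs])).
  move=> t [/andP[t0 t1] St]; have [->|tn1] := eqVneq t 1; first by left.
  right; split; first by rewrite t0 lt_neqAle tn1.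
  move: St => /eqP; rewrite -/(root S _) hrs rootZ ?lead_coef_eq0//.
  by rewrite root_prod_XsubC.
by rewrite finite_setU.
Qed.

Lemma negligible_finite (A : set R) : finite_set A -> mu.-negligible A.
Proof.
move=> fA; have cA : countable A by exact: finite_set_countable.
by apply/negligibleP; [exact: countable_measurable|exact: countable_lebesgue_measure0].
Qed.

Lemma aeS (P Q : R -> Prop) : (forall t, P t -> Q t) ->
  {ae mu, forall t, P t} -> {ae mu, forall t, Q t}.
Proof. by move=> PQ; apply: negligibleS => t; apply: contra_not; exact: PQ. Qed.

Lemma circle_ae_neq0 S : S != 0 ->
  {ae mu, forall t, `[0, 1]%classic t -> S.[expi t] != 0}.
Proof.
move=> /circle_zeros_finite /negligible_finite; apply: negligibleS => t /=.
move/not_implyP => [t01 /negP/negPn/eqP St].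
by split => //; rewrite in_itv/= in t01.
Qed.

Lemma measure01 : mu `[0, 1]%classic = 1%:E.
Proof. by rewrite lebesgue_measure_itv/= lte_fin ltr01 oppr0 adde0. Qed.

Lemma ae_exists01 (P : R -> Prop) :
  {ae mu, forall t, `[0, 1]%classic t -> P t} -> exists2 t, 0 <= t <= 1 & P t.
Proof.
move=> h; apply: contrapT => no.
have : mu.-negligible `[0, 1]%classic.
  apply: negligibleS h => t t01 /= ht; apply: no; exists t; last exact: ht.
  by move: t01; rewrite /= in_itv.
move=> /negligibleP => /(_ (measurable_itv _)) mu0.
have /eqP := etrans (esym measure01) mu0.
by rewrite onee_eq0.
Qed.

Lemma bounded01 (f : R -> R) : continuous f -> exists B, forall t, 0 <= t <= 1 -> f t <= B.
Proof.
move=> cf; have [c _ hc] := @EVT_max R f 0 1 ler01 (continuous_subspaceT cf).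
by exists (f c) => t t01; apply: hc; rewrite in_itv.
Qed.

Lemma bounded_below01 (f : R -> R) : continuous f -> (forall t, 0 <= t <= 1 -> 0 < f t) ->
  exists2 B, 0 < B & forall t, 0 <= t <= 1 -> B <= f t.
Proof.
move=> cf f0; have [c c01 hc] := @EVT_min R f 0 1 ler01 (continuous_subspaceT cf).
by exists (f c) => [|t t01]; [apply: f0|apply: hc]; rewrite in_itv in c01 *.
Qed.

(** The set is an interval of length x ending at t0, going right when t0 <= 1/2 and left otherwise,
    so that x <= 1/2 keeps it inside [0, 1]. *)
Lemma short_interval (phi : R -> \bar R) t0 x b : measurable_fun setT phi ->
  (forall t, 0 <= phi t)%E ->
  0 <= t0 <= 1 -> 0 < x <= 2^-1 -> 0 <= b ->
  {ae mu, forall t, `[0, 1]%classic t -> `|t - t0| <= x -> (b%:E <= phi t)%E} ->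
  exists A : set R, [/\ measurable A, A `<=` `[0, 1]%classic, mu A = x%:E &
    ((b * x)%:E <= \int[mu]_(t in A) phi t)%E].
Proof.
move=> mphi phi0 /andP[t00 t01] /andP[x0 x1] b0 hb.
have [a [a0 a1 ha]] : exists a, [/\ 0 <= a, a + x <= 1 & forall t, a <= t <= a + x -> `|t - t0| <= x].
  have [h|h] := leP t0 2^-1.
    by exists t0; split; [|lra|move=> t /andP[? ?]; rewrite ler_norml; apply/andP; split; lra].
  by exists (t0 - x); split; [lra|lra|move=> t /andP[? ?]; rewrite ler_norml; apply/andP; split; lra].
have muA : mu `[a, a + x]%classic = x%:E.
  by rewrite lebesgue_measure_itv/= lte_fin ltrDl x0 -EFinB; congr EFin; ring.
have A01 : `[a, a + x]%classic `<=` (`[0, 1]%classic : set R).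
  by move=> t /=; rewrite !in_itv/= => /andP[? ?]; apply/andP; split; lra.
exists `[a, a + x]%classic; split => //.
rewrite EFinM -muA -integral_cst; last exact: measurable_itv.
apply: ae_ge0_le_integral => //; first exact: measurable_funTS.
apply: aeS hb => t ht At; apply: ht; first exact: A01.
by apply: ha; rewrite /= in_itv in At.
Qed.

Lemma measurable_cmod_ratio T S :
  measurable_fun setT (fun t : R => (cmod T.[expi t] / cmod S.[expi t])%:E).
Proof.
have mP P : measurable_fun setT (fun t : R => cmod P.[expi t]).
  apply: continuous_measurable_fun; apply: continuous_cmod; apply: ccontinuous_poly.
  exact: ccontinuous_expi.
apply/measurable_EFinP; apply: measurable_funM => //.
exact: (measurable_ge0_inv (fun t => cmod_ge0 _)).
Qed.

(** No logarithm is computed: |S| is at most of order x within distance x of t0, so the integral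
    over a suitable interval of length x is bounded below independently of x, against the absolute
    continuity of the integral. A zero of [S] of any order qualifies. *)
Lemma simple_pole_not_integrable T S t0 : S != 0 -> 0 <= t0 <= 1 ->
  S.[expi t0] = 0 -> T.[expi t0] != 0 ->
  (\int[mu]_(t in `[0%R, 1%R]) (cmod T.[expi t] / cmod S.[expi t])%:E = +oo)%E.
Proof.
move=> S0 t01 St0 Tt0; apply: contrapT => /eqP fin.
pose f t := cmod T.[expi t] / cmod S.[expi t].
have f0 t : 0 <= f t by rewrite divr_ge0 ?cmod_ge0.
have mf : measurable_fun setT (EFin \o f) by exact: measurable_cmod_ratio.
have intf01 : mu.-integrable `[0%R, 1%R]%classic (EFin \o f).
  apply/integrableP; split; first exact: (measurable_funTS mf).
  under eq_integral do rewrite /= ger0_norm ?f0//.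
  by rewrite ltey.
have intf : mu.-integrable setT (EFin \o (f \_ `[0%R, 1%R]%classic)).
  by rewrite -restrict_EFin; apply: (integrable_mkcond _ _).1.
have [LT LT0 hLT] := poly_lipschitz T; have [LS LS0 hLS] := poly_lipschitz S.
have e1 t : cmod (expi t : C) <= 1 by rewrite cmod_expi.
set c := cmod T.[expi t0]; have c0 : 0 < c by rewrite cmod_gt0.
have pi0 := pi_gt0 R.
(* Lipschitz constants in the parameter; the added 1 makes them positive, hence invertible. *)
pose MT := LT * (4 * pi) + 1; pose MS := LS * (4 * pi) + 1.
have MT0 : 0 < MT by rewrite ltr_wpDl// !mulr_ge0// pi_ge0.
have MS0 : 0 < MS by rewrite ltr_wpDl// !mulr_ge0// pi_ge0.
have lipT t : `|t - t0| <= c / (2 * MT) -> c / 2 <= cmod T.[expi t].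
  move=> h; have : c - cmod T.[expi t] <= c / 2.
    apply: (le_trans (cmodB _ _)); apply: (le_trans (hLT _ _ (e1 _) (e1 _))).
    apply: (@le_trans _ _ (MT * (c / (2 * MT)))); last first.
      by rewrite le_eqVlt; apply/orP; left; apply/eqP; field; rewrite gt_eqF.
    rewrite distrC in h; set q := c / _ in h *.
    apply: (le_trans (ler_wpM2l LT0 (expi_lip t0 t))); rewrite mulrA.
    by apply: ler_pM => //; rewrite ?mulr_ge0 ?pi_ge0// /MT lerDl.
  lra.
have lipS t x : `|t - t0| <= x -> cmod S.[expi t] <= MS * x.
  move=> h; rewrite -[S.[_]]subr0 -St0; apply: (le_trans (hLS _ _ (e1 _) (e1 _))).
  apply: (le_trans (ler_wpM2l LS0 (expi_lip t t0))); rewrite mulrA.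
  by apply: ler_pM => //; rewrite ?mulr_ge0 ?pi_ge0// /MS lerDl.
(* Half of the lower bound c / (2 MS) that the short interval will give. *)
have e0 : 0 < c / (4 * MS) by rewrite divr_gt0// mulr_gt0.
have [d [d0 hd]] := integral_normr_continuous intf e0.
(* The three bounds keep the interval inside [0, 1], below the threshold [d] of absolute continuity,
   and where |T| is at least c / 2. *)
pose x := Num.min (2^-1) (Num.min (d / 2) (c / (2 * MT))).
have x0 : 0 < x by rewrite !lt_min invr_gt0 ltr0n !divr_gt0// mulr_gt0.
have [xh xd xT] : [/\ x <= 2^-1, x <= d / 2 & x <= c / (2 * MT)].
  by split; rewrite /x !ge_min lexx ?orbT.
have b0 : 0 <= c / (2 * MS * x) by rewrite divr_ge0 ?cmod_ge0// !mulr_ge0// ltW.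
have [A [mA A01 muA hA]] : exists A : set R, [/\ measurable A, A `<=` `[0, 1]%classic, mu A = x%:E &
    ((c / (2 * MS * x) * x)%:E <= \int[mu]_(t in A) (f t)%:E)%E].
  apply: (short_interval (t0 := t0)) => //; rewrite ?x0//.
  apply: aeS (circle_ae_neq0 S0) => t St tt hx; rewrite lee_fin /f.
  rewrite ler_pdivlMr ?cmod_gt0 ?St//.
  have := lipT t (le_trans hx xT); have := lipS t x hx; have := cmod_ge0 S.[expi t].
  move=> s0 s1 s2; apply: le_trans s2; rewrite mulrAC ler_pdivrMr ?mulr_gt0//.
  by have := ltW c0; nra.
have muAd : (mu A < d%:E)%E by rewrite muA lte_fin; lra.
have := hd A mA muAd; rewrite -lte_fin.
have fA : (\int[mu]_(t in A) (f t)%:E = \int[mu]_(t in A) (`|(f \_ `[0%R, 1%R]%classic) t|)%:E)%E.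
  apply: eq_integral => t /set_mem At; rewrite patchE ifT ?ger0_norm//.
  exact/mem_set/A01.
rewrite /Rintegral fineK -?fA; last first.
  rewrite ge0_fin_numE; last by apply: integral_ge0 => t _; rewrite lee_fin.
  apply: (@le_lt_trans _ _ (\int[mu]_(t in `[0%R, 1%R]) (f t)%:E)%E).
    apply: ge0_subset_integral => //; first exact: measurable_funTS.
    by move=> t _; rewrite lee_fin.
  by rewrite ltey.
move=> /(le_lt_trans hA); rewrite lte_fin.
have -> : c / (2 * MS * x) * x = c / (2 * MS) by field; rewrite !gt_eqF.
have : c / (2 * MS) = 2 * (c / (4 * MS)) by field; rewrite gt_eqF.
lra.
Qed.

(** Integrability makes every zero of [S] on the circle a zero of [T]. The common linear factor is
    cancelled, which lowers the size of [S], until no zero on the circle remains and |S| has a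
    positive minimum there. *)
Lemma integrable_ratio_bounded S T : S != 0 ->
  (\int[mu]_(t in `[0%R, 1%R]) (cmod T.[expi t] / cmod S.[expi t])%:E < +oo)%E ->
  exists B, forall t, 0 <= t <= 1 -> cmod T.[expi t] <= B * cmod S.[expi t].
Proof.
elim: {S}(size S) {-2}S T (leqnn (size S)) => [|n IH] S T.
  by rewrite leqn0 size_poly_eq0 => ->.
move=> sS S0 fin.
have cont P : continuous (fun t : R => cmod P.[expi t]).
  by apply: continuous_cmod; apply: ccontinuous_poly; exact: ccontinuous_expi.
have [[t0 t01 St0]|noz] := pselect (exists2 t, 0 <= t <= 1 & S.[expi t] = 0); last first.
  have [t t01|b b0 hb] := bounded_below01 (cont S).
    by rewrite cmod_gt0; apply/eqP => St; apply: noz; exists t.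
  have [D hD] := bounded01 (cont T).
  exists (`|D| / b) => t t01.
  apply: (le_trans (hD t t01)); apply: (le_trans (ler_norm D)).
  rewrite mulrAC ler_pdivlMr// ler_wpM2l// ?normr_ge0//.
  exact: hb.
have [Tt0|Tt0] := boolP (T.[expi t0] == 0); last first.
  by move: fin; rewrite (simple_pole_not_integrable S0 t01 St0).
have /factor_theorem[S' hS] : root S (expi t0) by apply/eqP.
have /factor_theorem[T' hT] : root T (expi t0) by [].
have S'0 : S' != 0 by apply: contraNneq S0 => S'0; rewrite hS S'0 mul0r.
have X0 : 'X - (expi t0)%:P != 0 :> {poly C} by rewrite polyXsubC_eq0.
have sS' : (size S' <= n)%N.
  by move: sS; rewrite hS size_Mmonic ?monicXsubC// size_XsubC addn2.
have [|B hB] := IH S' T' sS' S'0.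
  apply: le_lt_trans fin; apply: ae_ge0_le_integral => //.
  - by move=> t _; rewrite lee_fin divr_ge0 ?cmod_ge0.
  - by apply: measurable_funTS; exact: measurable_cmod_ratio.
  - by move=> t _; rewrite lee_fin divr_ge0 ?cmod_ge0.
  - by apply: measurable_funTS; exact: measurable_cmod_ratio.
  apply: aeS (circle_ae_neq0 X0) => t Xt tt.
  by rewrite hS hT !hornerM !cmodM -mulf_div divff ?mulr1// cmod_eq0 Xt.
exists B => t tt; rewrite hS hT !hornerM !cmodM mulrA.
by rewrite ler_wpM2r ?cmod_ge0// hB.
Qed.

End CircleAE.

(** * Means over the circle and Cauchy's theorem *)

Section CircleIntegral.
Variable R : realType.
Local Notation C := R[i].
Local Notation mu := (@lebesgue_measure R).
Implicit Types (F G : R -> C) (f g : R -> R) (P b : {poly C}) (z w : C).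

Definition cint F : C := Complex (\int[mu]_(t in `[0, 1]) complex.Re (F t))
  (\int[mu]_(t in `[0, 1]) complex.Im (F t)).

Lemma integrable01 f : continuous f -> mu.-integrable `[0, 1]%classic (EFin \o f).
Proof.
move=> cf; apply: continuous_compact_integrable; first exact: segment_compact.
exact: continuous_subspaceT.
Qed.

Lemma cintD F G : ccontinuous F -> ccontinuous G ->
  cint (fun t => F t + G t) = cint F + cint G.
Proof.
move=> [F1 F2] [G1 G2]; rewrite /cint; simpc; congr Complex.
- by rewrite -RintegralD//; [under eq_Rintegral do rewrite raddfD|exact: integrable01|exact: integrable01].
- by rewrite -RintegralD//; [under eq_Rintegral do rewrite raddfD|exact: integrable01|exact: integrable01].
Qed.

Lemma cintZ z F : ccontinuous F -> cint (fun t => z * F t) = z * cint F.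
Proof.
move=> [F1 F2]; case: z => a b; rewrite /cint; simpc.
have i1 c f : continuous f -> mu.-integrable `[0, 1]%classic (EFin \o (fun t => c * f t)).
  by move=> cf; apply: integrable01 => t; apply: cvgMr; exact: cf.
congr Complex.
- rewrite -!RintegralZl//; try exact: integrable01.
  rewrite -RintegralB//; try exact: i1.
  by apply: eq_Rintegral => t _; rewrite Re_mul.
- rewrite -!RintegralZl//; try exact: integrable01.
  rewrite -RintegralD//; try exact: i1.
  by apply: eq_Rintegral => t _; rewrite Im_mul.
Qed.

Lemma cint_conj F : ccontinuous F -> cint (fun t => conjc (F t)) = conjc (cint F).
Proof.
move=> [F1 F2]; rewrite /cint; simpc; congr Complex.
  by apply: eq_Rintegral => t _; case: (F t).
rewrite -mulN1r -RintegralZl//; last exact: integrable01.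
by apply: eq_Rintegral => t _; rewrite mulN1r; case: (F t).
Qed.

Lemma Rintegral01_bound f B : continuous f -> (forall t, 0 <= t <= 1 -> `|f t| <= B) ->
  `|\int[mu]_(t in `[0, 1]) f t| <= B.
Proof.
move=> cf fB; have i f' : continuous f' -> mu.-integrable `[0, 1]%classic (EFin \o f') := @integrable01 f'.
have cst c : (\int[mu]_(t in `[0, 1]) (fun=> c) t)%R = c :> R.
  rewrite Rintegral_cst//; transitivity (c * fine (1%:E : \bar R)); last by rewrite /= mulr1.
  by congr (c * fine _); exact: measure01.
rewrite ler_norml -{1}(cst (- B)) -{2}(cst B); apply/andP; split; apply: le_Rintegral => //;
  try (by apply: i => // t; exact: cvg_cst); try exact: i;
  by move=> t; rewrite /= in_itv/= => /fB; rewrite ler_norml => /andP[].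
Qed.

(** The factor 2 comes from bounding real and imaginary parts separately. *)
Lemma cint_bound F B : ccontinuous F -> (forall t, 0 <= t <= 1 -> cmod (F t) <= B) -> cmod (cint F) <= 2 * B.
Proof.
move=> [F1 F2] FB; rewrite (le_trans (cmod_le_ReIm _))// mulr2n mulrDl mul1r lerD//=.
  by apply: Rintegral01_bound => // t /FB; exact/le_trans/cmod_Re.
by apply: Rintegral01_bound => // t /FB; exact/le_trans/cmod_Im.
Qed.

Lemma cint_expiX k : (0 < k)%N -> cint (fun t => expi t ^+ k) = 0.
Proof.
move=> k0; pose a : R := 2 * pi * k%:R.
have a0 : a != 0 by rewrite gt_eqF// !mulr_gt0 ?pi_gt0// ltr0n.
have ex t : expi t ^+ k = Complex (cos (a * t)) (sin (a * t)).
  by rewrite expiX /expi /a !mulrA.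
have ak : a = pi *+ 2 *+ k by rewrite /a [2 * _]mulrC !mulr_natr.
have cosk j : cos (pi *+ 2 *+ j) = 1 :> R.
  by elim: j => [|j IH]; rewrite ?mulr0n ?cos0// mulrSr cosD cos2pi sin2pi mulr1 mulr0 subr0.
have sink j : sin (pi *+ 2 *+ j) = 0 :> R.
  by elim: j => [|j IH]; rewrite ?mulr0n ?sin0// mulrSr sinD cos2pi sin2pi mulr0 mulr1 IH addr0.
have dlin (x : R) : is_derive x 1 (fun t : R => a * t) a.
  by have := is_deriveZ a (is_derive_id x 1); rewrite /GRing.scale/= mulr1.
have ftc f Fp : (forall x : R, is_derive x 1 Fp (f x)) -> continuous f ->
    Fp 1 = Fp 0 -> \int[mu]_(t in `[0, 1]) f t = 0.
  move=> dF cf F01; rewrite /Rintegral.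
  have dr (x : R) : derivable Fp x 1 := @ex_derive _ _ _ _ _ _ _ (dF x).
  have cF : continuous Fp by move=> x; apply: differentiable_continuous; apply/derivable1_diffP.
  rewrite (@continuous_FTC2 _ f Fp 0 1)//.
  - by rewrite F01 subee.
  - exact: continuous_subspaceT.
  - split; [by []|apply: cvg_at_right_filter; exact: cF|apply: cvg_at_left_filter; exact: cF].
  - by move=> x _; rewrite derive1E derive_val.
rewrite /cint; congr Complex.
- under eq_Rintegral do rewrite ex /=.
  apply: (ftc _ (fun t => a^-1 * sin (a * t))).
  + move=> x; have := is_deriveZ a^-1 (is_derive1_comp (is_derive_sin _) (dlin x)).
    by rewrite /GRing.scale/= mulrCA mulVf// mulr1.
  + move=> x; apply: continuous_comp; [exact: mulrl_continuous|exact: continuous_cos].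
  + by rewrite mulr0 mulr1 ak sink sin0.
- under eq_Rintegral do rewrite ex /=.
  apply: (ftc _ (fun t => - a^-1 * cos (a * t))).
  + move=> x; have := is_deriveZ (- a^-1) (is_derive1_comp (is_derive_cos _) (dlin x)).
    by rewrite /GRing.scale/= !mulNr mulrN opprK mulrCA mulVf// mulr1.
  + move=> x; apply: continuous_comp; [exact: mulrl_continuous|exact: continuous_sin].
  + by rewrite mulr0 mulr1 ak cosk cos0.
Qed.


Lemma cint_mulX_poly P : cint (fun t => expi t * P.[expi t]) = 0.
Proof.
(* The exponent is generalised because each step of Horner's recursion raises it by one. *)
suff h k : (0 < k)%N -> cint (fun t => expi t ^+ k * P.[expi t]) = 0.
  by have := h 1%N isT; under eq_fun do rewrite expr1.
have cX j : ccontinuous (fun t : R => expi t ^+ j).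
  by under eq_fun do rewrite -hornerXn; apply: ccontinuous_poly; exact: ccontinuous_expi.
elim/poly_ind: P k => [|P c IH] k k0.
  under eq_fun do rewrite horner0 mulr0 -[0](mul0r 0).
  by rewrite cintZ ?mul0r//; exact: ccontinuous_cst.
under eq_fun do rewrite hornerMXaddC mulrDr [P.[_] * _]mulrC mulrA -exprSr [_ * c]mulrC.
rewrite cintD.
- by rewrite IH// add0r cintZ// cint_expiX// mulr0.
- by apply: ccontinuousM => //; apply: ccontinuous_poly; exact: ccontinuous_expi.
- by apply: ccontinuousM => //; exact: ccontinuous_cst.
Qed.

Lemma bernoulli_le (d : R) k : 0 <= d -> 1 + k%:R * d <= (1 + d) ^+ k.
Proof.
move=> d0; elim: k => [|k IH]; first by rewrite mul0r addr0 expr0.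
rewrite exprS; apply: (@le_trans _ _ ((1 + d) * (1 + k%:R * d))).
  by rewrite -natr1; have := ler0n R k; nra.
by rewrite ler_wpM2l// addr_ge0.
Qed.

Lemma geometric_bounded_eq0 (r x B : R) : 1 < r -> 0 <= x -> (forall k, r ^+ k * x <= B) -> x = 0.
Proof.
move=> r1 x0 h; apply/eqP; rewrite eq_le x0 andbT leNgt; apply/negP => xgt0.
have d0 : 0 < r - 1 by rewrite subr_gt0.
have := archi_boundP (normr_ge0 (B / ((r - 1) * x))).
set k := Num.bound _ => hk; have := h k.
have := bernoulli_le k (ltW d0); rewrite subrKC => bk.
apply/negP; rewrite -ltNge; apply: (@lt_le_trans _ _ ((1 + k%:R * (r - 1)) * x)); last first.
  by rewrite ler_wpM2r.
have : B / ((r - 1) * x) < k%:R by apply: le_lt_trans hk; exact: ler_norm.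
by rewrite ltr_pdivrMr ?mulr_gt0//; nra.
Qed.

(* Dividing by one more factor z - a, the integrals x_k of z^k times the integrand
   satisfy x_(k+1) = a x_k; being bounded while |a| > 1, they vanish. *)
Lemma cint_mulX_div_prod (rs : seq C) P : (forall z, z \in rs -> 1 < cmod z) ->
  cint (fun t => expi t * P.[expi t] / (\prod_(z <- rs) ('X - z%:P)).[expi t]) = 0.
Proof.
elim: rs P => [|a rs IH] P hrs.
  rewrite big_nil; under eq_fun do rewrite hornerC divr1.
  exact: cint_mulX_poly.
rewrite big_cons; set Q := \prod_(z <- rs) _ in IH *.
have a1 : 1 < cmod a by apply: hrs; rewrite mem_head.
have rs1 z : z \in rs -> 1 < cmod z by move=> zrs; apply: hrs; rewrite inE zrs orbT.
have {}IH P' := IH P' rs1.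
have Q0 t : Q.[expi t] != 0.
  apply/negP; rewrite -/(root Q _) root_prod_XsubC => /rs1.
  by rewrite cmod_expi ltxx.
have a0 t : ('X - a%:P).[expi t] != 0.
  by rewrite hornerXsubC subr_eq0; apply: contraTneq a1 => <-; rewrite cmod_expi ltxx.
have aQ0 t : (('X - a%:P) * Q).[expi t] != 0 by rewrite hornerM mulf_neq0.
have ce : ccontinuous (@expi R) := @ccontinuous_expi R.
have cP P' : ccontinuous (fun t : R => P'.[expi t]) := ccontinuous_poly P' ce.
pose x P' := cint (fun t => expi t * P'.[expi t] / (('X - a%:P) * Q).[expi t]).
have cx P' : ccontinuous (fun t : R => expi t * P'.[expi t] / (('X - a%:P) * Q).[expi t]).
  apply: ccontinuousM; first exact: ccontinuousM.
  by apply: ccontinuousV.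
have xS k : x ('X^k * P) = a ^+ k * x P.
  elim: k => [|k IHk]; first by rewrite !expr0 !mul1r.
  rewrite [a ^+ _]exprS -mulrA -IHk /x -cintZ//.
  have -> : (fun t => expi t * ('X^(k.+1) * P).[expi t] / (('X - a%:P) * Q).[expi t]) =
    (fun t => a * (expi t * ('X^k * P).[expi t] / (('X - a%:P) * Q).[expi t]) +
       expi t * ('X^k * P).[expi t] / Q.[expi t]).
    apply/funext => t; have := a0 t; have := Q0 t; rewrite !hornerM !hornerXn hornerXsubC => q0 e0.
    by rewrite [expi t ^+ k.+1]exprS; field; rewrite q0.
  rewrite cintD ?IH ?addr0//; last first.
    by apply: ccontinuousM; [exact: ccontinuousM|exact: ccontinuousV].
  by apply: ccontinuousM => //; exact: ccontinuous_cst.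
have [B hB] := bounded01 (continuous_cmod (cx P)).
suff : cmod (x P) = 0 by move=> /eqP; rewrite cmod_eq0 => /eqP.
apply: (geometric_bounded_eq0 (B := 2 * B) a1); first exact: cmod_ge0.
move=> k; rewrite -cmodX -cmodM -xS; apply: cint_bound => // t t01.
apply: le_trans (hB t t01); rewrite !cmodM hornerM cmodM hornerXn cmodX.
by rewrite cmod_expi expr1n !mul1r.
Qed.

(** Cauchy's theorem in mean value form: z P / Q is holomorphic on the closed disk and vanishes at
    its centre. Splitting [Q] into linear factors, all with roots of modulus above 1, reduces it to
    the product form. *)
Lemma cint_mulX_div P Q : (forall z, cmod z <= 1 -> Q.[z] != 0) ->
  cint (fun t => expi t * P.[expi t] / Q.[expi t]) = 0.
Proof.
move=> hQ; have Q0 : Q != 0.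
  by apply: contraTneq (hQ 0 _) => [->|]; rewrite ?horner0 ?eqxx// cmod0.
have [rs hrs] := closed_field_poly_normal Q.
have rs1 z : z \in rs -> 1 < cmod z.
  move=> zrs; rewrite ltNge; apply/negP => /hQ /negP; apply.
  by rewrite -/(root Q z) hrs rootZ ?lead_coef_eq0// root_prod_XsubC.
have := cint_mulX_div_prod ((lead_coef Q)^-1 *: P) rs1.
congr (cint _ = 0); apply/funext => t.
rewrite [in RHS]hrs !hornerZ invfM; ring.
Qed.

End CircleIntegral.

Section CircleSurjective.
Variable R : realType.

(** The arccosine covers the upper half circle; a negative imaginary part is reached by the
    reflected parameter 1 - s. *)
Lemma expi_surj (z : R[i]) : cmod z = 1 -> exists2 t, 0 <= t <= 1 & z = expi t.
Proof.
case: z => a b z1; have ab : a ^+ 2 + b ^+ 2 = 1.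
  by have := cabs2E (Complex a b); rewrite z1 expr1n.
have [a11l a11r] : -1 <= a /\ a <= 1 by split; nra.
have a11 : -1 <= a <= 1 by rewrite a11l.
have pi0 := pi_gt0 R.
pose s := acos a / (2 * pi).
have s2 : 2 * pi * s = acos a by rewrite /s mulrC divfK// mulf_neq0// gt_eqF.
have [s0 s1] : 0 <= acos a /\ acos a <= pi by split; [exact: acos_ge0|exact: acos_lepi].
have sb : Num.sqrt (1 - a ^+ 2) = `|b| by rewrite -ab addrC addKr sqrtr_sqr.
have [b0|b0] := leP 0 b.
  exists s; first by apply/andP; split; nra.
  by rewrite /expi s2 acosK ?in_itv// sin_acos// sb ger0_norm.
exists (1 - s); first by apply/andP; split; nra.
have e : 2 * pi * (1 - s) = pi *+ 2 - acos a by rewrite mulrBr mulr1 s2 mulr_natl.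
rewrite /expi e cosB sinB cos2pi sin2pi !mul1r !mul0r sin_acos// sb ltr0_norm//.
by rewrite acosK ?in_itv// addr0 sub0r opprK.
Qed.

End CircleSurjective.

(** * Zero-free slices and elimination of the second variable *)

Section Slices.
Variable R : realType.
Local Notation C := R[i].
Implicit Types (w z : C) (b u v : {poly {poly C}}).
Variable p : {poly {poly C}}.
Hypothesis p_neq0 : forall w z, cmod w < 1 -> cmod z < 1 -> eval2 p w z != 0.

Let p0 : {poly C} := p.[0].

Lemma eval2_at0 b w : eval2 b w 0 = (b.[0]).[w].
Proof. by rewrite /eval2 polyC0. Qed.

Lemma const_coef_neq0 : p0 != 0.
Proof.
apply/eqP => h; have := @p_neq0 0 0; rewrite eval2_at0 -/p0 h horner0 eqxx cmod0 ltr01.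
by move=> /(_ isT isT).
Qed.

(* All roots a of the slice have |a| >= 1, so each factor satisfies |z - a| >= |a| (1 - |z|). *)
Lemma slice_lower_bound w z : cmod w < 1 -> cmod z < 1 ->
  cmod (eval2 p w 0) * (1 - cmod z) ^+ size p <= cmod (eval2 p w z).
Proof.
move=> w1 z1; have z0 := cmod_ge0 z.
have [rs hrs] := closed_field_poly_normal (slice p w).
have Q0 : slice p w != 0.
  by apply: contraNneq (@p_neq0 w 0 w1 _) => [h|]; rewrite ?cmod0 ?ltr01// -horner_slice h horner0.
have rs1 a : a \in rs -> 1 <= cmod a.
  move=> ars; rewrite leNgt; apply/negP => /(p_neq0 w1); rewrite -horner_slice.
  by rewrite -/(root _ a) hrs rootZ ?lead_coef_eq0// root_prod_XsubC ars.
have szrs : (size rs <= size p)%N.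
  have : (size (slice p w) <= size p)%N by exact: size_poly.
  by rewrite hrs size_scale ?lead_coef_eq0// size_prod_XsubC => /ltnW.
have prodle : cmod (\prod_(a <- rs) ('X - a%:P)).[0] * (1 - cmod z) ^+ size rs <=
    cmod (\prod_(a <- rs) ('X - a%:P)).[z].
  elim: rs rs1 {hrs szrs} => [|a rs IH] rs1.
    by rewrite !big_nil !hornerC expr0 mulr1.
  rewrite !big_cons !hornerM !cmodM exprS !hornerXsubC sub0r cmodN.
  have {}IH := IH (fun c h => rs1 c (@mem_behead _ (a :: rs) c h)).
  have a1 := rs1 a (mem_head _ _).
  have : cmod a * (1 - cmod z) <= cmod (z - a).
    by have := cmodB a z; rewrite -[cmod (a - z)]cmodN opprB; nra.
  move: IH; set A := cmod _.[0]; set B := cmod _.[z]; set E := _ ^+ _ => IH h.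
  have -> : cmod a * A * ((1 - cmod z) * E) = cmod a * (1 - cmod z) * (A * E) by ring.
  have d0 : 0 <= 1 - cmod z by rewrite subr_ge0 ltW.
  by apply: ler_pM => //; rewrite mulr_ge0 ?cmod_ge0// exprn_ge0.
rewrite -!horner_slice hrs !hornerZ !cmodM -mulrA ler_wpM2l ?cmod_ge0//.
apply: le_trans prodle; rewrite ler_wpM2l ?cmod_ge0//.
by apply: ler_wiXn2l => //; [rewrite subr_ge0 ltW|rewrite gerBl].
Qed.

(** A quantitative Hurwitz argument: the lower bound |p(w',0)| (1 - |z|)^k, with k the size of [p],
    holds at the interior points w' = (1 - e) w and survives the limit e -> 0, where p(w,0) is
    nonzero. *)
Lemma slice_neq0_disk w z : cmod w = 1 -> p0.[w] != 0 -> cmod z < 1 -> eval2 p w z != 0.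
Proof.
move=> w1 p0w z1.
have [L1 L10 hL1] := poly_lipschitz p.[z%:P]; have [L2 L20 hL2] := poly_lipschitz p0.
set q := (1 - cmod z) ^+ size p.
have q0 : 0 < q by rewrite exprn_gt0// subr_gt0.
have q1 : q <= 1 by apply: exprn_ile1; [rewrite subr_ge0 ltW|rewrite gerBl cmod_ge0].
have key e : 0 < e -> e < 1 -> cmod p0.[w] * q - cmod (eval2 p w z) <= (L1 + L2) * e.
  move=> e0 e1; pose w' := real_complex R (1 - e) * w.
  have w'1 : cmod w' = 1 - e by rewrite cmodM w1 mulr1 cmod_real ger0_norm// subr_ge0 ltW.
  have ww' : cmod (w - w') = e.
    have -> : w - w' = real_complex R e * w by rewrite /w' rmorphB rmorph1; ring.
    by rewrite cmodM w1 mulr1 cmod_real ger0_norm// ltW.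
  have w1' : cmod w' < 1 by rewrite w'1; lra.
  have h1 := slice_lower_bound w1' z1; rewrite eval2_at0 -/p0 -/q in h1.
  have := hL1 w' w (ltW w1') ; rewrite w1 lexx -[cmod (w' - w)]cmodN opprB ww' => /(_ isT) h2.
  have := hL2 w w' _ (ltW w1'); rewrite w1 lexx ww' => /(_ isT) h3.
  have h4 := cmodB (p.[z%:P]).[w'] (p.[z%:P]).[w].
  have h5 := cmodB p0.[w] p0.[w'].
  have h6 : (cmod p0.[w] - cmod p0.[w']) * q <= L2 * e.
    apply: (@le_trans _ _ (L2 * e * q)); first by rewrite ler_wpM2r ?(ltW q0)//; lra.
    by rewrite ler_piMr// mulr_ge0// ltW.
  rewrite /eval2 in h1 *; rewrite mulrBl in h6; rewrite mulrDl.
  set X := cmod p0.[w] * q in h6 *; set Y := cmod p0.[w'] * q in h6 h1; lra.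
rewrite -cmod_gt0 ltNge; apply/negP => P0.
have c0 : 0 < cmod p0.[w] * q by rewrite mulr_gt0// cmod_gt0.
set c := _ * q in key c0.
(* Small enough that the error (L1 + L2) e is at most half of [c]. *)
pose e := Num.min (2^-1) (c / (2 * (L1 + L2 + 1))).
have d0 : 0 < L1 + L2 + 1 by rewrite ltr_wpDl// addr_ge0.
have e0 : 0 < e by rewrite lt_min invr_gt0 ltr0n divr_gt0// mulr_gt0.
have e1 : e < 1 by rewrite gt_min; apply/orP; left; lra.
have := key e e0 e1.
have : e <= c / (2 * (L1 + L2 + 1)) by rewrite ge_min lexx orbT.
rewrite ler_pdivlMr ?mulr_gt0//; nra.
Qed.

(** The gcd is taken in z over C[w]. If it had positive degree in z, then at a w where its leading
    coefficient and the scalars of pseudo-division do not vanish, its slice would have a root, which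
    is a common zero of [p] and [q]. Hence it is constant in z, and the pseudo-Bezout relation gives
    [r]. *)
Lemma bezout_elimination (q : {poly {poly C}}) :
  (forall Q : {poly C}, Q != 0 -> exists2 w, Q.[w] != 0 &
     forall z, ~ (eval2 p w z = 0 /\ eval2 q w z = 0)) ->
  exists u v (r : {poly C}), r != 0 /\ r%:P = u * p + v * q.
Proof.
move=> hw; have pn0 : p != 0.
  by apply: contraNneq const_coef_neq0 => h; rewrite /p0 h horner0.
have gn0 : gcdp p q != 0 by rewrite gcdp_eq0 negb_and pn0.
have [[u v] /=] := Pdiv.Idomain.Bezoutp p q.
case/Pdiv.Idomain.eqpP => -[c1 c2] /= /andP[c10 c20] hc.
have [sg|sg] := leqP (size (gcdp p q)) 1.
  have gE := size1_polyC sg; move: gn0; rewrite gE polyC_eq0 => gn0.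
  exists (c1%:P * u), (c1%:P * v), (c2 * (gcdp p q)`_0); split; first by rewrite mulf_neq0.
  by rewrite -!mulrA -mulrDr !mul_polyC hc {2}gE polyCM mul_polyC.
have /Pdiv.Idomain.dvdpP[[a s] /= a0 hs] := Pdiv.Idomain.dvdp_gcdl p q.
have /Pdiv.Idomain.dvdpP[[a' s'] /= a'0 hs'] := Pdiv.Idomain.dvdp_gcdr p q.
have [w + nocommon] := hw (a * a' * lead_coef (gcdp p q))
  (mulf_neq0 (mulf_neq0 a0 a'0) (etrans (congr1 negb (lead_coef_eq0 _)) gn0)).
rewrite !hornerM !mulf_eq0 !negb_or => /andP[/andP[aw a'w] lw].
have : size (slice (gcdp p q) w) != 1%N by rewrite size_map_poly_id0// gtn_eqF.
move=> /closed_rootP[z]; rewrite /root horner_slice => /eqP gz.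
exfalso; apply: (nocommon z); split; apply/eqP.
- have /eqP := congr1 (fun P => eval2 P w z) hs.
  by rewrite -mul_polyC !eval2M eval2C gz mulr0 mulf_eq0 (negPf aw).
- have /eqP := congr1 (fun P => eval2 P w z) hs'.
  by rewrite -mul_polyC !eval2M eval2C gz mulr0 mulf_eq0 (negPf a'w).
Qed.

End Slices.

(** * Rationality of the mean of 1/|p|^2 over a slice *)

Section SliceIntegral.
Variable R : realType.
Local Notation C := R[i].
Local Notation mu := (@lebesgue_measure R).
Implicit Types (w z : C) (b u v : {poly {poly C}}).
Variable p : {poly {poly C}}.
Hypothesis p_neq0 : forall w z, cmod w < 1 -> cmod z < 1 -> eval2 p w z != 0.

Lemma ccontinuous_eval2 b w : ccontinuous (fun t : R => eval2 b w (expi t)).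
Proof.
under eq_fun do rewrite -horner_slice.
exact/ccontinuous_poly/ccontinuous_expi.
Qed.

Lemma ccontinuous_expiX k : ccontinuous (fun t : R => expi t ^+ k).
Proof.
under eq_fun do rewrite -hornerXn.
exact/ccontinuous_poly/ccontinuous_expi.
Qed.

Definition slices_zero_free (Z : {poly C}) := Z != 0 /\
  forall w, cmod w = 1 -> Z.[w] != 0 -> forall z, cmod z <= 1 -> eval2 p w z != 0.

Definition slice_mean w : C :=
  cint (fun t => real_complex R (cabs2 (eval2 p w (expi t)))^-1).

(** One step of the Taylor expansion at z = 0: b/p is its value at 0 plus z times b' / (p(w,0)
    p). *)
Lemma slice_divX b : exists b', (p.[0])%:P * b = (b.[0])%:P * p + b' * 'X.
Proof.
have /factor_theorem[b' hb] : root ((p.[0])%:P * b - (b.[0])%:P * p) 0.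
  by rewrite /root hornerD hornerN !hornerM !hornerC mulrC subrr.
by exists b'; rewrite -[X in b' * X]subr0 -polyC0 -hb addrC subrK.
Qed.

Lemma cint_slice_divX Z k b b' w : slices_zero_free Z -> cmod w = 1 ->
  Z.[w] != 0 -> (p.[0]).[w] != 0 -> (p.[0])%:P * b = (b.[0])%:P * p + b' * 'X ->
  cint (fun t => conjc (expi t ^+ k) * (eval2 b w (expi t) / eval2 p w (expi t))) =
  (b.[0]).[w] / (p.[0]).[w] * cint (fun t => conjc (expi t ^+ k)) +
  (p.[0]).[w]^-1 * cint (fun t => conjc (expi t ^+ k) *
     (expi t * eval2 b' w (expi t) / eval2 p w (expi t))).
Proof.
move=> [Z0 hZ] w1 Zw pw hb.
have P0 t : eval2 p w (expi t) != 0 by apply: hZ => //; rewrite cmod_expi.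
have ck : ccontinuous (fun t : R => conjc (expi t ^+ k)).
  by apply: ccontinuous_conj; exact: ccontinuous_expiX.
have c2 : ccontinuous (fun t : R => conjc (expi t ^+ k) *
     (expi t * eval2 b' w (expi t) / eval2 p w (expi t))).
  apply: ccontinuousM => //; apply: ccontinuousM.
    by apply: ccontinuousM; [exact: ccontinuous_expi|exact: ccontinuous_eval2].
  by apply: ccontinuousV => //; exact: ccontinuous_eval2.
rewrite -cintZ// -cintZ// -cintD; try by apply: ccontinuousM => //; exact: ccontinuous_cst.
congr cint; apply/funext => t.
have := congr1 (fun P => eval2 P w (expi t)) hb.
rewrite eval2D !eval2M !eval2C [eval2 'X _ _]/eval2 hornerX hornerC => hbt.
have := P0 t => P0t; apply: (mulfI pw).
transitivity (conjc (expi t ^+ k) * ((p.[0]).[w] * eval2 b w (expi t)) / eval2 p w (expi t)).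
  by field.
by rewrite hbt; field; rewrite P0t.
Qed.

(** The mean is the k-th Taylor coefficient in z of b/p. For k = 0 it is b(w,0) / p(w,0), and one
    Taylor step lowers k at the cost of a division by p(w,0). *)
Lemma cint_conjX_rational Z k b : slices_zero_free Z -> rational_on_circle
  (fun w => cint (fun t => conjc (expi t ^+ k) * (eval2 b w (expi t) / eval2 p w (expi t)))).
Proof.
move=> gZ; have [Z0 hZ] := gZ; have p00 := const_coef_neq0 p_neq0.
have Zp0 : Z * p.[0] != 0 by rewrite mulf_neq0.
elim: k b => [|k IH] b; have [b' hb] := slice_divX b.
  apply: (rational_ext Zp0 (F := fun w => (b.[0]).[w] / (p.[0]).[w])); last first.
    by apply: rational_div => //; exact: rational_poly.
  move=> w w1; rewrite hornerM mulf_eq0 negb_or => /andP[Zw pw].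
  rewrite (cint_slice_divX 0 gZ w1 Zw pw hb); under [X in _ + _ * cint X]eq_fun do
    rewrite expr0 conjc1 mul1r -!horner_slice.
  rewrite cint_mulX_div ?mulr0 ?addr0; last by move=> z z1; rewrite horner_slice hZ.
  under eq_fun do rewrite expr0 conjc1.
  have -> : cint (fun=> 1 : C) = 1 :> C; last by rewrite mulr1.
  rewrite /cint /Rintegral/= !integral_cst//= mul0e.
  by have -> := @measure01 R; rewrite mul1e.
apply: (rational_ext Zp0 (F := fun w => cint (fun t => conjc (expi t ^+ k) *
    (eval2 b' w (expi t) / eval2 p w (expi t))) / (p.[0]).[w])); last first.
  by apply: rational_div => //; exact: IH.
move=> w w1; rewrite hornerM mulf_eq0 negb_or => /andP[Zw pw].
rewrite (cint_slice_divX k.+1 gZ w1 Zw pw hb) cint_conj; last exact: ccontinuous_expiX.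
rewrite cint_expiX// conjc0 mulr0 add0r mulrC; congr (cint _ / _).
apply/funext => t; rewrite exprS conjcM.
have ee : conjc (expi t) * expi t = 1 :> C.
  by rewrite mulrC mulr_conjc cabs2E cmod_expi expr1n.
by rewrite -[RHS]mul1r -ee; ring.
Qed.

(** Divide r = u p + v q by |p|^2 on the circle. Since q = z^(d+1) w^e conj p, the second term
    becomes w^e z (z^d v / p), of mean zero by Cauchy's theorem. The first is u / conj p, the
    conjugate of z^-a w^-c u' / p, whose mean is a Taylor coefficient of u' / p divided by w^c. *)
Lemma slice_mean_rational Z (q : {poly {poly C}}) d e u v (r : {poly C}) :
  slices_zero_free Z -> r != 0 ->
  (forall w z, cmod w = 1 -> cmod z = 1 ->
     eval2 q w z = z ^+ d.+1 * w ^+ e * conjc (eval2 p w z)) ->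
  r%:P = u * p + v * q ->
  rational_on_circle slice_mean.
Proof.
move=> gZ r0 hq huv; have [Z0 hZ] := gZ.
have [u' [a [c hu0]]] := eval2_reflect u; have hu := eval2_reflect_torus hu0.
have Zr0 : Z * r != 0 by rewrite mulf_neq0.
apply: (rational_ext Zr0 (F := fun w => conjc (cint (fun t => conjc (expi t ^+ a) *
    (eval2 u' w (expi t) / eval2 p w (expi t))) / ('X^c).[w]) / r.[w])); last first.
  apply: rational_div => //; apply: rational_conj; apply: rational_div.
    by rewrite expf_neq0 ?polyX_eq0.
  exact: cint_conjX_rational gZ.
move=> w w1; rewrite hornerM mulf_eq0 negb_or => /andP[Zw rw].
have w0 : w != 0 by rewrite -cmod_gt0 w1.
have P0 t : eval2 p w (expi t) != 0 by apply: hZ => //; rewrite cmod_expi.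
apply: (mulIf rw); rewrite mulfVK// hornerXn.
have cV : ccontinuous (fun t : R => (eval2 p w (expi t))^-1).
  by apply: ccontinuousV => //; exact: ccontinuous_eval2.
have cuP : ccontinuous (fun t : R => conjc (expi t ^+ a) *
    (eval2 u' w (expi t) / eval2 p w (expi t))).
  apply: ccontinuousM; last by apply: ccontinuousM => //; exact: ccontinuous_eval2.
  by apply: ccontinuous_conj; exact: ccontinuous_expiX.
have cJ : ccontinuous (fun t : R => real_complex R (cabs2 (eval2 p w (expi t)))^-1).
  apply: ccontinuous_real => t; apply: cvgV.
    by rewrite cabs2E expf_neq0// cmod_eq0.
  exact: (continuous_cabs2 (ccontinuous_eval2 _ _)).
have cvX : ccontinuous (fun t : R => expi t * ('X^d * slice v w).[expi t] / (slice p w).[expi t]).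
  under eq_fun do rewrite [(slice p w).[_]]horner_slice.
  apply: ccontinuousM => //; apply: ccontinuousM; first exact: ccontinuous_expi.
  exact/ccontinuous_poly/ccontinuous_expi.
have cC : ccontinuous (fun t : R => conjc (conjc (expi t ^+ a) *
    (eval2 u' w (expi t) / eval2 p w (expi t)))) by exact: ccontinuous_conj.
rewrite mulrC /slice_mean -cintZ// conjcM mulrC -cint_conj// -cintZ//.
(* The zero added on the right is w^e times the vanishing mean of z (z^d v / p). *)
rewrite -[RHS]addr0 -[X in _ = _ + X](mulr0 (w ^+ e)).
rewrite -(@cint_mulX_div _ ('X^d * slice v w) (slice p w)); last first.
  by move=> z z1; rewrite horner_slice hZ.
rewrite -cintZ// -cintD; try by apply: ccontinuousM => //; exact: ccontinuous_cst.
congr cint; apply/funext => t.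
have ee : conjc (expi t) * expi t = 1 :> C.
  by rewrite mulrC mulr_conjc cabs2E cmod_expi expr1n.
have := congr1 (fun P => eval2 P w (expi t)) huv.
rewrite eval2D !eval2M !eval2C hq ?cmod_expi// => ->.
rewrite fmorphV/= -mulr_conjc hu ?cmod_expi// !hornerM hornerXn !horner_slice.
have := P0 t; set P := eval2 p w (expi t) => P0t.
have cP0 : conjc P != 0 by rewrite conjc_eq0.
have e0 := expi_neq0 t.
have ce : conjc (expi t) = (expi t)^-1 :> C by apply: (mulIf e0); rewrite ee mulVf.
have cw : conjc w = w^-1 by exact: conjc_unit.
rewrite !conjcM !conjc_inv !conjcX !conjcK ce cw exprS !exprVn invrK.
by field; rewrite P0t cP0 !expf_neq0.
Qed.

End SliceIntegral.

(** * Tonelli's theorem on the unit square, in both orders *)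

Section SquareIntegral.
Variable R : realType.
Local Notation mu := (@lebesgue_measure R).
Variable G : R * R -> \bar R.
Hypothesis mG : measurable_fun setT G.
Hypothesis G0 : forall x, (0 <= G x)%E.

Let m01 : measurable (`[0%R, 1%R]%classic : set (measurableTypeR R)).
Proof. exact: measurable_itv. Qed.

Let msq : measurable (@sq01 R : set (measurableTypeR R * measurableTypeR R)).
Proof. exact: measurableX. Qed.

Let patch_ge0 D x : (0 <= (G \_ D) x)%E.
Proof. by rewrite patchE; case: ifP. Qed.

Lemma integral_sq01_inner s : `[0, 1]%classic s ->
  (\int[mu]_t (G \_ (@sq01 R)) (s, t) = \int[mu]_(t in `[0%R, 1%R]) G (s, t))%E.
Proof.
move=> s01; rewrite [RHS]integral_mkcond; apply: eq_integral => t _.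
rewrite !patchE; congr (if _ then _ else _).
by apply/idP/idP => /set_mem h; apply/mem_set; [case: h|split].
Qed.

(** Extending the integrand by zero outside a strip turns the inner integral into one over the whole
    line, to which Tonelli's theorem applies. *)
Lemma measurable_inner_integral :
  measurable_fun setT (fun s => \int[mu]_(t in `[0%R, 1%R]) G (s, t))%E.
Proof.
pose D : set (measurableTypeR R * measurableTypeR R) := setT `*` `[0%R, 1%R]%classic.
have mD : measurable D by exact: measurableX.
have mGD : measurable_fun setT (G \_ D).
  by apply/(measurable_restrictT _ mD); exact: measurable_funTS.
have := measurable_fun_fubini_tonelli_F (m2 := mu) _ mGD (patch_ge0 D).
apply: eq_measurable_fun => s _; rewrite /fubini_F [RHS]integral_mkcond.
apply: eq_integral => t _; rewrite !patchE; congr (if _ then _ else _).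
by apply/idP/idP => /set_mem h; apply/mem_set; [case: h|split].
Qed.

Lemma integral_sq01 :
  (\int[@mu2 R]_(x in @sq01 R) G x =
   \int[mu]_(s in `[0%R, 1%R]) \int[mu]_(t in `[0%R, 1%R]) G (s, t))%E.
Proof.
have mGD : measurable_fun setT (G \_ (@sq01 R)).
  by apply/(measurable_restrictT _ msq); exact: measurable_funTS.
rewrite integral_mkcond /mu2 fubini_tonelli1//.
rewrite [RHS]integral_mkcond; apply: eq_integral => s _.
rewrite [in RHS]patchE; case: ifPn => [/set_mem s01|/negP s01].
  exact: integral_sq01_inner.
rewrite /fubini_F integral0_eq// => t _; rewrite patchE ifF//.
by apply/negP => /set_mem[/= h _]; apply: s01; apply/mem_set.
Qed.

End SquareIntegral.

Section SquareIntegralSwap.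
Variable R : realType.
Local Notation mu := (@lebesgue_measure R).

Lemma integral_sq01_swap (G : R * R -> \bar R) : measurable_fun setT G ->
  (forall x, 0 <= G x)%E ->
  (\int[@mu2 R]_(x in @sq01 R) G x =
   \int[mu]_(t in `[0%R, 1%R]) \int[mu]_(s in `[0%R, 1%R]) G (s, t))%E.
Proof.
move=> mG G0.
have msq : measurable (@sq01 R : set (measurableTypeR R * measurableTypeR R)).
  by apply: measurableX; exact: measurable_itv.
have mGD : measurable_fun setT (G \_ (@sq01 R)).
  by apply/(measurable_restrictT _ msq); exact: measurable_funTS.
rewrite integral_mkcond /mu2 fubini_tonelli2//; last first.
  by move=> x; rewrite patchE; case: ifP.
rewrite [RHS]integral_mkcond; apply: eq_integral => t _.
rewrite [in RHS]patchE /fubini_G; case: ifPn => [/set_mem t01|/negP t01].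
  rewrite [RHS]integral_mkcond; apply: eq_integral => s _.
  rewrite !patchE; congr (if _ then _ else _).
  by apply/idP/idP => /set_mem h; apply/mem_set; [case: h|split].
rewrite integral0_eq// => s _; rewrite patchE ifF//.
by apply/negP => /set_mem[/= _ h]; apply: t01; apply/mem_set.
Qed.

End SquareIntegralSwap.

(** * The bound of |f|^2 by a multiple of |p| *)

Section MainEstimate.
Variable R : realType.
Local Notation C := R[i].
Local Notation mu := (@lebesgue_measure R).
Implicit Types (w z : C) (s t : R).
Variable p : {poly {poly C}}.
Hypothesis p_neq0 : forall w z, cmod w < 1 -> cmod z < 1 -> eval2 p w z != 0.

Lemma slice_mean_eq w : (forall z, cmod z = 1 -> eval2 p w z != 0) ->
  (\int[mu]_(t in `[0%R, 1%R]) ((cabs2 (eval2 p w (expi t)))^-1)%:E =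
   (cmod (slice_mean p w))%:E)%E.
Proof.
move=> P0; pose f t := (cabs2 (eval2 p w (expi t)))^-1.
have f0 t : 0 <= f t by rewrite invr_ge0 cabs2_ge0.
have cf : continuous f.
  move=> t; apply: cvgV; last exact: (continuous_cabs2 (ccontinuous_eval2 _ _)).
  by rewrite cabs2E expf_neq0// cmod_eq0 P0 ?cmod_expi.
have -> : slice_mean p w = real_complex R (\int[mu]_(t in `[0, 1]) f t).
  rewrite /slice_mean /cint /=; congr Complex.
  by rewrite Rintegral_cst// mul0r.
rewrite cmod_real ger0_norm; last by apply: Rintegral_ge0 => t _; exact: f0.
rewrite /Rintegral fineK//; apply: integrable_fin_num => //.
exact: (integrable01 cf).
Qed.

(* On an arc of length comparable to |p| around the given point, |p| at most doubles. *)
Lemma slice_mean_lower_bound : exists2 K, 0 < K & forall w z, cmod w = 1 -> cmod z = 1 ->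
  (forall z', cmod z' = 1 -> eval2 p w z' != 0) ->
  1 <= K * cmod (slice_mean p w) * cmod (eval2 p w z).
Proof.
have [L L0 hL] := eval2_lipschitz p; have [B hB] := eval2_bounded p.
have pi0 := pi_gt0 R.
(* The Lipschitz constant of p(w,.) in the parameter, enlarged by 2|B| so that x = d / L' is at most
   1/2, and by 1 to be positive. *)
pose L' := L * (4 * pi) + 2 * `|B| + 1.
have L'0 : 0 < L' by rewrite ltr_wpDl// addr_ge0// !mulr_ge0// pi_ge0.
(* On an interval of length x = d / L' the integrand is at least 1 / (4 d^2), whence J >= 1 / (4 L'
   d). *)
exists (4 * L'); first by rewrite mulr_gt0.
move=> w z w1 z1 P0; have [t0 t01 zE] := expi_surj z1.
set d := cmod (eval2 p w z).
have d0 : 0 < d by rewrite cmod_gt0 P0.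
have dB : d <= `|B| by rewrite (le_trans (hB _ _ _ _)) ?ler_norm ?w1 ?z1.
pose x := d / L'; have xL : L' * x = d by rewrite /x mulrC divfK// gt_eqF.
have x0 : 0 < x by rewrite divr_gt0.
have LB : 2 * `|B| <= L'.
  by rewrite /L' -addrA addrCA lerDl addr_ge0// !mulr_ge0// pi_ge0.
have x2 : x <= 2^-1 by rewrite ler_pdivrMr// mulrC ler_pdivlMr//; lra.
have mf : measurable_fun setT (fun t : R => ((cabs2 (eval2 p w (expi t)))^-1)%:E).
  apply/measurable_EFinP; apply: (measurable_ge0_inv (fun t => cabs2_ge0 _)).
  by apply: continuous_measurable_fun; apply: continuous_cabs2; exact: ccontinuous_eval2.
have f0 t : (0 <= ((cabs2 (eval2 p w (expi t)))^-1)%:E)%E by rewrite lee_fin invr_ge0 cabs2_ge0.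
have [|||A [mA A01 muA hA]] := @short_interval R _ t0 x ((4 * d ^+ 2)^-1) mf f0 t01.
- by rewrite x0.
- by rewrite invr_ge0 mulr_ge0// sqr_ge0.
- apply: aeW => t _ tx; rewrite lee_fin cabs2E.
  have Pt : 0 < cmod (eval2 p w (expi t)) by rewrite cmod_gt0 P0// cmod_expi.
  rewrite lef_pV2 ?posrE ?exprn_gt0 ?mulr_gt0 ?exprn_gt0//.
  have : cmod (eval2 p w (expi t)) <= 2 * d.
    have := cmodB (eval2 p w (expi t)) (eval2 p w z).
    have := hL w (expi t) z; rewrite w1 z1 cmod_expi lexx => /(_ isT isT isT).
    have : L * cmod (expi t - z) <= d.
      rewrite zE -xL; apply: (le_trans (ler_wpM2l L0 (expi_lip t t0))); rewrite mulrA.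
      apply: ler_pM => //; first by rewrite !mulr_ge0// pi_ge0.
      by rewrite /L' -addrA lerDl addr_ge0// mulr_ge0.
    by rewrite -/d; lra.
  by move=> Pd; rewrite -[4](_ : 2 ^+ 2 = _); [rewrite -exprMn ler_pXn2r// nnegrE ?mulr_ge0 ?ltW|ring].
have := slice_mean_eq P0; set J := cmod (slice_mean p w) => hJ.
have : (((4 * d ^+ 2)^-1 * x)%:E <= J%:E)%E.
  rewrite -hJ; apply: (le_trans hA); apply: ge0_subset_integral => //.
  exact: measurable_funTS.
rewrite lee_fin => h.
have e : 4 * L' * ((4 * d ^+ 2)^-1 * x) * d = 1.
  by rewrite -xL; field; rewrite !gt_eqF.
rewrite -[leLHS]e; apply: ler_wpM2r; first exact: ltW.
by rewrite ler_wpM2l// mulr_ge0// ltW.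
Qed.

Variable f : {poly C}.
Hypothesis f_neq0 : f != 0.
Hypothesis f_int : (\int[mu]_(s in `[0%R, 1%R]) \int[mu]_(t in `[0%R, 1%R])
  (cabs2 f.[expi s] / cabs2 (eval2 p (expi s) (expi t)))%:E < +oo)%E.

Let G (x : R * R) := (cabs2 f.[expi x.1] / cabs2 (eval2 p (expi x.1) (expi x.2)))%:E.

Let mG : measurable_fun setT G.
Proof.
apply: measurable_cabs2_ratio; first exact/cmeasurable_poly/cmeasurable_expi.
by apply: cmeasurable_eval2; exact: cmeasurable_expi.
Qed.

Let G0 x : (0 <= G x)%E.
Proof. by rewrite lee_fin divr_ge0 ?cabs2_ge0. Qed.

Let I s := (\int[mu]_(t in `[0%R, 1%R]) G (s, t))%E.

Let I0 s : (0 <= I s)%E.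
Proof. by apply: integral_ge0. Qed.

Let mI : measurable_fun setT I.
Proof. exact: measurable_inner_integral. Qed.

(** For almost every w the inner integral of |f/p|^2 is finite and f(w) is nonzero. Then f(w)^2 is
    bounded on the circle by a multiple of |p(w,.)|^2, so p(w,.) cannot vanish there. *)
Lemma exists_zero_free_slice (Q : {poly C}) : Q != 0 ->
  exists w, [/\ cmod w = 1, Q.[w] != 0 & forall z, cmod z = 1 -> eval2 p w z != 0].
Proof.
move=> Q0; have p00 := const_coef_neq0 p_neq0.
have aeI : {ae mu, forall s, `[0, 1]%classic s -> I s \is a fin_num}.
  apply: integrable_ae => //; apply/integrableP; split; first exact: measurable_funTS.
  by under eq_integral do rewrite gee0_abs//.
have QfP : Q * f * p.[0] != 0 by rewrite !mulf_neq0.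
have : {ae mu, forall s, `[0, 1]%classic s -> I s \is a fin_num /\ (Q * f * p.[0]).[expi s] != 0}.
  have := negligibleU aeI (circle_ae_neq0 QfP); apply: negligibleS => s /= h.
  by apply: contrapT => /not_orP[/contrapT h1 /contrapT h2]; apply: h => s01; split; [exact: h1|exact: h2].
move=> /ae_exists01[s s01 []]; rewrite !hornerM !mulf_eq0 !negb_or => Ifin /andP[/andP[Qs fs] ps].
exists (expi s); split; rewrite ?cmod_expi// => z z1.
have [t t01 ->] := expi_surj z1.
set P := slice p (expi s).
have P0 : P != 0.
  apply: contraNneq ps => h; rewrite -eval2_at0 -horner_slice -/P h horner0.
  by [].
have [|B hB] := @integrable_ratio_bounded R (P ^+ 2) (f.[expi s] ^+ 2)%:P (expf_neq0 2 P0).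
  apply: (@le_lt_trans _ _ (I s)); last by rewrite -ge0_fin_numE.
  rewrite le_eqVlt; apply/orP; left; apply/eqP; apply: eq_integral => t' _.
  by rewrite hornerC /G/= !cabs2E -!cmodX horner_exp horner_slice.
apply/negP => /eqP Pz.
have := hB t t01; rewrite hornerC horner_exp horner_slice Pz expr0n/= cmod0 mulr0.
rewrite leNgt cmod_gt0 expf_neq0//.
Qed.

Lemma poly_sqr_le : exists K (Q : {poly C}), Q != 0 /\
  forall w z, cmod w = 1 -> cmod z = 1 -> Q.[w] != 0 ->
  cmod f.[w] ^+ 2 <= K * cmod (eval2 p w z).
Proof.
have p00 := const_coef_neq0 p_neq0.
have [q0 [d [e hq0]]] := eval2_reflect p.
(* The extra factor z makes the term containing [v] vanish in mean. *)
pose q := q0 * 'X.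
have hq w z : cmod w = 1 -> z != 0 ->
    eval2 q w z = z ^+ d.+1 * w ^+ e * conjc (eval2 p w (conjc z)^-1).
  by move=> w1 z0; rewrite /q eval2M hq0// [eval2 'X _ _]/eval2 hornerX hornerC exprS; ring.
have hqT := eval2_reflect_torus hq.
have [Q Q0|u [v [r [r0 hr]]]] := bezout_elimination p_neq0 (q := q).
  (* On such a slice a zero z of p(w,.) satisfies |z| > 1; if it were also a zero of [q], then 1 /
     conj z would be a zero of p(w,.) inside the disk. *)
  have [w [w1 + Pw]] := exists_zero_free_slice (mulf_neq0 Q0 p00).
  rewrite hornerM mulf_eq0 negb_or => /andP[Qw pw].
  exists w => // z [pz]; have z1 : 1 < cmod z.
    rewrite ltNge le_eqVlt; apply/negP => /orP[/eqP /Pw|/(slice_neq0_disk p_neq0 w1 pw)].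
      by rewrite pz eqxx.
    by rewrite pz eqxx.
  have z0 : z != 0 by rewrite -cmod_gt0 (lt_trans ltr01).
  have w0 : w != 0 by rewrite -cmod_gt0 w1.
  rewrite hq// => /eqP; rewrite !mulf_eq0 !expf_eq0 (negPf z0) (negPf w0) !andbF/=.
  rewrite conjc_eq0; apply/negP; apply: (slice_neq0_disk p_neq0 w1 pw).
  by rewrite cmodV cmodC invf_lt1// (lt_trans ltr01).
(* On the circle [q] is a unimodular multiple of conj p, so a zero of p(w,.) there is a zero of both
   and forces r(w) = 0. *)
have gZ : slices_zero_free p (r * p.[0]).
  split; first by rewrite mulf_neq0.
  move=> w w1; rewrite hornerM mulf_eq0 negb_or => /andP[rw pw] z.
  rewrite le_eqVlt => /predU1P[z1|]; last exact: slice_neq0_disk.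
  apply: contraNneq rw => pz; have := congr1 (fun P => eval2 P w z) hr.
  by rewrite eval2C eval2D (eval2M u) (eval2M v) pz hqT// pz conjc0 !mulr0 addr0 => ->.
have [T [S [S0 hJ]]] := slice_mean_rational p_neq0 gZ r0 hqT hr.
have [K K0 hK] := slice_mean_lower_bound.
have SZ0 : S * (r * p.[0]) != 0 by rewrite !mulf_neq0.
have gen w : cmod w = 1 -> (S * (r * p.[0])).[w] != 0 ->
    (forall z, cmod z = 1 -> eval2 p w z != 0) /\
    cmod (slice_mean p w) = cmod T.[w] / cmod S.[w].
  move=> w1; rewrite hornerM mulf_eq0 negb_or => /andP[Sw Zw]; split.
    by move=> z z1; apply: gZ.2 => //; rewrite z1.
  by rewrite hJ// cmodM cmodV.
(* Generically |f^2 T / S| = |f|^2 J, which is the inner integral of |f/p|^2 and therefore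
   integrable in w. *)
have [|B hB] := @integrable_ratio_bounded R S (f ^+ 2 * T) S0.
  apply: (@le_lt_trans _ _ (\int[mu]_(s in `[0%R, 1%R]) I s)%E) => //.
  apply: ae_ge0_le_integral => //.
  - by move=> s _; rewrite lee_fin divr_ge0 ?cmod_ge0.
  - by apply: measurable_funTS; exact: measurable_cmod_ratio.
  - exact: measurable_funTS.
  apply: aeS (circle_ae_neq0 SZ0) => s hs s01.
  have [P0 J] := gen _ (cmod_expi s) (hs s01).
  rewrite hornerM horner_exp cmodM cmodX -mulrA -J.
  rewrite EFinM -slice_mean_eq// -ge0_integralZl//; last 3 first.
  - apply: measurable_funTS; apply/measurable_EFinP; apply: (measurable_ge0_inv (fun t => cabs2_ge0 _)).
    by apply: continuous_measurable_fun; apply: continuous_cabs2; exact: ccontinuous_eval2.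
  - by move=> t _; rewrite lee_fin invr_ge0 cabs2_ge0.
  - by rewrite lee_fin sqr_ge0.
  by rewrite le_eqVlt; apply/orP; left; apply/eqP; apply: eq_integral => t _; rewrite /G/= -cabs2E EFinM.
exists (K * B), (S * (r * p.[0])); split => // w z w1 z1 Zw.
have [P0 J] := gen w w1 Zw; have := hK w z w1 z1 P0; rewrite J.
have Sw : 0 < cmod S.[w].
  by move: Zw; rewrite hornerM mulf_eq0 negb_or cmod_gt0 => /andP[].
have [s s01 ws] := expi_surj w1; have := hB s s01; rewrite -ws hornerM horner_exp cmodM cmodX.
rewrite -ler_pdivrMr// => h1 h2.
set F := cmod f.[w] ^+ 2 in h1 *; set P := cmod (eval2 p w z) in h2 *.
have F0 : 0 <= F by rewrite sqr_ge0.
apply: (@le_trans _ _ (F * (K * (cmod T.[w] / cmod S.[w]) * P))); first by rewrite ler_peMr.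
have -> : F * (K * (cmod T.[w] / cmod S.[w]) * P) = K * (F * cmod T.[w] / cmod S.[w]) * P.
  by ring.
by rewrite ler_wpM2r ?cmod_ge0// ler_wpM2l// ltW.
Qed.

End MainEstimate.

(** * The ideal I_p, the determinants and their T-factors *)

Section IpIdeal.
Variable R : realType.
Local Notation C := R[i].
Implicit Types (p q a : {poly {poly C}}) (P D : {poly C}).

Let msq : measurable (@sq01 R : set (measurableTypeR R * measurableTypeR R)).
Proof. by apply: measurableX; exact: measurable_itv. Qed.

Lemma measurable_torus_ratio p q :
  measurable_fun setT (fun x : R * R => (cabs2 (torus q x) / cabs2 (torus p x))%:E).
Proof. by apply: measurable_cabs2_ratio; apply: cmeasurable_eval2; exact: cmeasurable_expi. Qed.

Lemma torus_ratio_ge0 p q (x : R * R) : (0 <= (cabs2 (torus q x) / cabs2 (torus p x))%:E)%E.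
Proof. by rewrite lee_fin divr_ge0 ?cabs2_ge0. Qed.

Lemma in_Ip_dominated p q a B : (forall x, cmod (torus a x) <= B * cmod (torus q x)) ->
  in_Ip p q -> in_Ip p a.
Proof.
move=> h; rewrite /in_Ip => hq.
apply: (@le_lt_trans _ _ ((B ^+ 2)%:E *
   \int[@mu2 R]_(x in @sq01 R) (cabs2 (torus q x) / cabs2 (torus p x))%:E)%E); last first.
  by rewrite lte_mul_pinfty// lee_fin sqr_ge0.
rewrite -ge0_integralZl//; last 3 first.
- by apply: measurable_funTS; exact: measurable_torus_ratio.
- by move=> x _; exact: torus_ratio_ge0.
- by rewrite lee_fin sqr_ge0.
apply: ge0_le_integral => //.
- by move=> x _; exact: torus_ratio_ge0.
- by apply: measurable_funTS; exact: measurable_torus_ratio.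
- by apply: measurable_funeM; apply: measurable_funTS; exact: measurable_torus_ratio.
move=> x _; rewrite -EFinM lee_fin mulrA ler_wpM2r ?invr_ge0 ?cabs2_ge0//.
by rewrite !cabs2E -exprMn ler_pXn2r// nnegrE ?cmod_ge0// (le_trans _ (h x)) ?cmod_ge0.
Qed.

Lemma in_IpD p q a : in_Ip p q -> in_Ip p a -> in_Ip p (q + a).
Proof.
rewrite /in_Ip => hq ha.
have mr b : measurable_fun (@sq01 R) (fun x => (cabs2 (torus b x) / cabs2 (torus p x))%:E).
  by apply: measurable_funTS; exact: measurable_torus_ratio.
have fin : (\int[@mu2 R]_(x in @sq01 R) ((cabs2 (torus q x) / cabs2 (torus p x))%:E +
    (cabs2 (torus a x) / cabs2 (torus p x))%:E) < +oo)%E.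
  rewrite (ge0_integralD _ msq (fun x _ => torus_ratio_ge0 p q x) (mr q)
    (fun x _ => torus_ratio_ge0 p a x) (mr a)).
  exact: lte_add_pinfty.
(* The factor 2 comes from |q + a|^2 <= 2 (|q|^2 + |a|^2). *)
apply: (@le_lt_trans _ _ (2%:E * \int[@mu2 R]_(x in @sq01 R)
    ((cabs2 (torus q x) / cabs2 (torus p x))%:E + (cabs2 (torus a x) / cabs2 (torus p x))%:E))%E); last first.
  by rewrite lte_mul_pinfty// lee_fin.
rewrite -ge0_integralZl//; last 2 first.
- exact: (emeasurable_funD (mr q) (mr a)).
- by move=> x _; apply: adde_ge0; exact: torus_ratio_ge0.
apply: ge0_le_integral => //.
- by move=> x _; exact: torus_ratio_ge0.
- exact: mr.
- by apply: measurable_funeM; exact: (emeasurable_funD (mr q) (mr a)).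
move=> x _; rewrite -EFinD -EFinM lee_fin -mulrDl mulrA ler_wpM2r ?invr_ge0 ?cabs2_ge0//.
rewrite /torus eval2D; case: (eval2 q _ _) => c d; case: (eval2 a _ _) => c' d'.
rewrite /cabs2/=; have := sqr_ge0 (c - c'); have := sqr_ge0 (d - d'); nra.
Qed.

Lemma in_IpM p q a : in_Ip p q -> in_Ip p (a * q).
Proof.
have [B hB] := eval2_bounded a; apply: (in_Ip_dominated (B := B)) => x.
by rewrite /torus eval2M cmodM ler_wpM2r ?cmod_ge0// hB ?cmod_expi.
Qed.

Lemma in_Ip0 p : in_Ip p 0.
Proof.
rewrite /in_Ip integral0_eq// => x _.
by rewrite /torus eval2_0 cabs2E cmod0 expr0n mul0r.
Qed.

Lemma in_Ip_comb N p (a e : 'I_N -> {poly {poly C}}) :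
  (forall i, in_Ip p (e i)) -> in_Ip p (\sum_i a i * e i).
Proof.
move=> he; apply: (big_ind (in_Ip p)) => [|q r|i _]; first exact: in_Ip0.
- exact: in_IpD.
- exact: in_IpM.
Qed.

(* First row of adj(E) E = det(E) 1, applied to the vector (1, z2, z2^2, ...). *)
Lemma det_E2mat_comb N (e : 'I_N.+1 -> {poly {poly C}}) :
  (forall i, (size (e i) <= N.+1)%N) ->
  exists a : 'I_N.+1 -> {poly C}, (\det (E2mat e))%:P = \sum_i (a i)%:P * e i.
Proof.
move=> se; exists (fun i => (\adj (E2mat e)) ord0 i).
have eE i : e i = \sum_(k < N.+1) (E2mat e i k)%:P * 'X^k.
  apply/polyP => l; rewrite coef_sum.
  under eq_bigr do rewrite mxE coefCM coefXn.
  have [ll|ll] := ltnP l N.+1.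
    rewrite (bigD1 (Ordinal ll))//= eqxx mulr1 big1 ?addr0// => k kl.
    rewrite [l == k]eq_sym (_ : (k == l :> nat) = false) ?mulr0//.
    by apply: contraNF kl => /eqP kl; apply/eqP/val_inj.
  rewrite nth_default ?(leq_trans (se i))// big1// => k _.
  by rewrite gtn_eqF ?mulr0// (leq_trans (ltn_ord k)).
under eq_bigr => i _ do rewrite (eE i) mulr_sumr.
rewrite exchange_big/=.
transitivity (\sum_(k < N.+1) (((\adj (E2mat e)) *m E2mat e) ord0 k)%:P * 'X^k).
  rewrite mul_adj_mx big_ord_recl !mxE/= ?eqxx mulr1n expr0 mulr1 big1 ?addr0// => k _.
  by rewrite !mxE/= mulr0n mul0r.
apply: eq_bigr => k _; rewrite mxE rmorph_sum mulr_suml.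
by apply: eq_bigr => i _; rewrite rmorphM mulrA.
Qed.

(** Exchanging the variables turns one matrix into the other, so the expansion of the determinant is
    proved for one of them and transferred. *)
Lemma E1mat_swap N (e : 'I_N -> {poly {poly C}}) : E1mat e = E2mat (fun i => swapXY (e i)).
Proof.
apply/matrixP => i k; rewrite !mxE; apply/polyP => l.
rewrite coef_poly coef_swapXY; case: ltnP => // h.
by rewrite (nth_default 0 h) coef0.
Qed.

(** Every number is a root of the zero polynomial: 0 is not of modulus 1, which excludes g = 0, and
    1 is, which excludes a zero cofactor. *)
Lemma T_factor_neq0 (f g : {poly C}) : T_factor f g -> f != 0 /\ g != 0.
Proof.
move=> [g1 [-> hg1 hg]].
have g0 : g != 0.
  apply/eqP => g0; have := hg 0; rewrite g0 root0 normr0 => /(_ isT) /eqP.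
  by rewrite eq_sym oner_eq0.
have g10 : g1 != 0.
  by apply/eqP => g10; have := hg1 1; rewrite g10 root0 normr1 eqxx => /(_ isT).
by rewrite mulf_neq0.
Qed.

(** The cofactor has no zeros on the circle, so by compactness its modulus has a positive minimum
    there. This passes membership in I_p from the determinant to its T-factor. *)
Lemma T_factor_le (f g : {poly C}) : T_factor f g -> exists B, forall t : R,
  cmod g.[expi t] <= B * cmod f.[expi t].
Proof.
move=> [g1 [-> hg1 hg]].
have ng1 t : 0 < cmod g1.[expi t].
  by rewrite cmod_gt0; apply/negP => /hg1 /negP; apply; rewrite cmodE cmod_expi.
have [||c c0 hc] := @bounded_below01 R (fun t => cmod g1.[expi t]).
- by apply: continuous_cmod; apply: ccontinuous_poly; exact: ccontinuous_expi.
- by move=> t _.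
exists c^-1 => t; rewrite hornerM cmodM mulrA ler_peMl ?cmod_ge0//.
rewrite ler_pdivlMl// mulr1; have [t' t01 ->] := expi_surj (cmod_expi t).
exact: hc.
Qed.

(** Serves the degenerate bidegrees n = 0 or m = 0, where one of the two matrices has constant
    entries. *)
Lemma size_det_const N (M : 'M[{poly C}]_N) : (forall i j, (size (M i j) <= 1)%N) ->
  (size (\det M) <= 1)%N.
Proof.
move=> hM; have -> : M = map_mx polyC (map_mx (fun P : {poly C} => P`_0) M).
  by apply/matrixP => i j; rewrite !mxE -size1_polyC.
by rewrite det_map_mx size_polyC_leq1.
Qed.

Lemma T_factor_const (f g : {poly C}) : T_factor f g -> (size f <= 1)%N ->
  exists2 c : C, c != 0 & g = c%:P.
Proof.
move=> hfg sf; have [f0 g0] := T_factor_neq0 hfg; case: hfg => g1 [fE _ _].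
have sg : (size g <= 1)%N by apply: leq_trans sf; apply: dvdp_leq => //; rewrite fE dvdp_mull.
exists g`_0; last exact: size1_polyC.
by rewrite -polyC_eq0 -size1_polyC.
Qed.

(** The index set is nonempty because a row of the adjugate is selected. *)
Lemma in_Ip_T_factor1 N p (e : 'I_N.+1 -> {poly {poly C}}) h :
  (forall i, (size (e i) <= N.+1)%N) -> (forall i, in_Ip p (e i)) ->
  T_factor (\det (E2mat e)) h -> in_Ip p h%:P.
Proof.
move=> se he /T_factor_le[B hB]; have [a ha] := det_E2mat_comb se.
have : in_Ip p (\det (E2mat e))%:P by rewrite ha; exact: in_Ip_comb.
by apply: (in_Ip_dominated (B := B)) => x; rewrite /torus !eval2C.
Qed.

Lemma in_Ip_T_factor2 N p (e : 'I_N.+1 -> {poly {poly C}}) g :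
  (forall i j, (size ((e i)`_j)%R <= N.+1)%N) -> (forall i, in_Ip p (e i)) ->
  T_factor (\det (E1mat e)) g -> in_Ip p (g^:P).
Proof.
move=> se he /T_factor_le[B hB].
have [i|a] := @det_E2mat_comb _ (fun i => swapXY (e i)).
  by apply/leq_sizeP => k hk; apply/polyP => l; rewrite coef_swapXY coef0 nth_default// (leq_trans (se i l)).
rewrite -E1mat_swap => /(congr1 (@swapXY _)).
rewrite swapXY_polyC [X in _ = X]rmorph_sum/= => ha.
have : in_Ip p (\det (E1mat e))^:P.
  rewrite ha (eq_bigr (fun i => (a i)^:P * e i)); first exact: in_Ip_comb.
  by move=> i _; rewrite rmorphM/= swapXY_polyC swapXYK.
by apply: (in_Ip_dominated (B := B)) => x; rewrite /torus !eval2_map.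
Qed.

End IpIdeal.

(** * From pointwise estimates to essential boundedness *)

Section FinalEstimates.
Variable R : realType.
Local Notation C := R[i].
Implicit Types (p : {poly {poly C}}) (g h : {poly C}) (w z : C).

Lemma bidisk_neq0 p : no_zeros_bidisk p ->
  forall w z, cmod w < 1 -> cmod z < 1 -> eval2 p w z != 0.
Proof. by move=> hp w z w1 z1; apply: hp; rewrite cmod_lt1. Qed.

Lemma in_Ip_sqr_le1 p h : no_zeros_bidisk p -> h != 0 -> in_Ip p h%:P ->
  exists K (Q : {poly C}), Q != 0 /\ forall w z, cmod w = 1 -> cmod z = 1 -> Q.[w] != 0 ->
    cmod h.[w] ^+ 2 <= K * cmod (eval2 p w z).
Proof.
move=> /bidisk_neq0 hp h0; rewrite /in_Ip integral_sq01; last 2 first.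
- exact: measurable_torus_ratio.
- exact: torus_ratio_ge0.
move=> hint; apply: (poly_sqr_le hp h0).
by under eq_integral => s _ do under eq_integral => t _ do rewrite -(eval2C h (expi s) (expi t)).
Qed.

Lemma in_Ip_sqr_le2 p g : no_zeros_bidisk p -> g != 0 -> in_Ip p g^:P ->
  exists K (Q : {poly C}), Q != 0 /\ forall w z, cmod w = 1 -> cmod z = 1 -> Q.[z] != 0 ->
    cmod g.[z] ^+ 2 <= K * cmod (eval2 p w z).
Proof.
move=> /bidisk_neq0 hp g0; rewrite /in_Ip integral_sq01_swap; last 2 first.
- exact: measurable_torus_ratio.
- exact: torus_ratio_ge0.
move=> hint; have hp' w z : cmod w < 1 -> cmod z < 1 -> eval2 (swapXY p) w z != 0.
  by move=> w1 z1; rewrite eval2_swap hp.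
have [|K [Q [Q0 hK]]] := poly_sqr_le hp' g0.
  under eq_integral => s _ do under eq_integral => t _ do
    rewrite eval2_swap -(eval2_map g (expi t) (expi s)).
  exact: hint.
by exists K, Q; split => // w z w1 z1 Qz; have := hK z w z1 w1 Qz; rewrite eval2_swap.
Qed.

Lemma circle_zeros_negligible1 (Q : {poly C}) : Q != 0 ->
  (@mu2 R).-negligible [set x : R * R | @sq01 R x /\ Q.[expi x.1] = 0].
Proof.
move=> /circle_zeros_finite fZ; set Z := [set t : R | _] in fZ.
have cZ : countable Z by exact: finite_set_countable.
have mZ : measurable (Z : set (measurableTypeR R)) by exact: countable_measurable.
have m01 : measurable (`[0%R, 1%R]%classic : set (measurableTypeR R)) by exact: measurable_itv.
exists (Z `*` `[0, 1]%classic); split; first exact: measurableX.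
- rewrite /mu2 product_measure1E//.
  exact: (etrans (congr1 (fun e => e * _)%E (countable_lebesgue_measure0 cZ)) (mul0e _)).
- by move=> x [[/= x1 x2] Qx]; split => //; split => //; rewrite in_itv in x1.
Qed.

Lemma circle_zeros_negligible2 (Q : {poly C}) : Q != 0 ->
  (@mu2 R).-negligible [set x : R * R | @sq01 R x /\ Q.[expi x.2] = 0].
Proof.
move=> /circle_zeros_finite fZ; set Z := [set t : R | _] in fZ.
have cZ : countable Z by exact: finite_set_countable.
have mZ : measurable (Z : set (measurableTypeR R)) by exact: countable_measurable.
have m01 : measurable (`[0%R, 1%R]%classic : set (measurableTypeR R)) by exact: measurable_itv.
exists (`[0, 1]%classic `*` Z); split; first exact: measurableX.
- rewrite /mu2 product_measure1E//.
  exact: (etrans (congr1 (fun e => _ * e)%E (countable_lebesgue_measure0 cZ)) (mule0 _)).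
- by move=> x [[/= x1 x2] Qx]; split => //; split => //; rewrite in_itv in x2.
Qed.

(** The exempted zeros of [Q1] and [Q2] fill finitely many segments of the square, of measure zero;
    off them |g h q / p| <= K B. *)
Lemma in_Ipinf_of_le p g h : (exists K (Q1 Q2 : {poly C}), [/\ Q1 != 0, Q2 != 0 &
    forall w z, cmod w = 1 -> cmod z = 1 -> Q1.[w] != 0 -> Q2.[z] != 0 ->
    cmod h.[w] * cmod g.[z] <= K * cmod (eval2 p w z)]) ->
  forall q : {poly {poly C}}, in_Ipinf p (g^:P * h%:P * q).
Proof.
move=> [K [Q1 [Q2 [Q10 Q20 hK]]]] q; have [B hB] := eval2_bounded q.
exists ((K * B) ^+ 2).
have := negligibleU (circle_zeros_negligible1 Q10) (circle_zeros_negligible2 Q20).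
apply: negligibleS => x /= hx; apply: contrapT => /not_orP[n1 n2]; apply: hx => sx.
have q1 : Q1.[expi x.1] != 0 by apply/eqP => h1; apply: n1.
have q2 : Q2.[expi x.2] != 0 by apply/eqP => h2; apply: n2.
have := hK _ _ (cmod_expi x.1) (cmod_expi x.2) q1 q2.
have := hB (expi x.1) (expi x.2); rewrite !cmod_expi lexx => /(_ isT isT).
rewrite /torus !eval2M eval2_map eval2C !cabs2E !cmodM.
set P := cmod (eval2 p _ _); set G := cmod g.[_]; set H := cmod h.[_]; set q' := cmod _ => hq hP.
(* At a zero of [p] the quotient is 0, since dividing by zero gives 0. *)
have [P0|P0] := eqVneq P 0; first by rewrite P0 expr0n/= invr0 mulr0 sqr_ge0.
have Pgt0 : 0 < P by rewrite lt_neqAle eq_sym P0 cmod_ge0.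
have B0 : 0 <= B by apply: le_trans hq; exact: cmod_ge0.
have K0 : 0 <= K.
  by rewrite -(pmulr_lge0 _ Pgt0); apply: le_trans hP; rewrite mulr_ge0 ?cmod_ge0.
rewrite ler_pdivrMr ?exprn_gt0// -exprMn ler_pXn2r ?nnegrE ?mulr_ge0 ?cmod_ge0//.
have -> : K * B * P = (K * P) * B by ring.
by rewrite [G * H]mulrC; apply: ler_pM; rewrite ?mulr_ge0 ?cmod_ge0.
Qed.

End FinalEstimates.

(** The estimate for g needs a nonempty basis, that is n > 0, and the one for h needs m > 0. If n =
    0 the entries of E_2 are constants, so h is a nonzero constant; if m = 0 the same holds for E_1
    and g. Hence four cases. *)
Theorem theorem8p1 (R : realType) (n m : nat) (p : {poly {poly R[i]}})
    (e1 : 'I_n -> {poly {poly R[i]}}) (e2 : 'I_m -> {poly {poly R[i]}})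
    (g h : {poly R[i]}) :
  semi_stable n m p ->
  onb p (E1space n m p) e1 ->
  onb p (E2space n m p) e2 ->
  T_factor (\det (E1mat e1)) g ->
  T_factor (\det (E2mat e2)) h ->
  forall q : {poly {poly R[i]}}, in_Ip p q -> in_Ipinf p (g^:P * h%:P * q).
Proof.
move=> [[dX dY] hp _] [E1 _ _] [E2 _ _] Tg Th q _; apply: in_Ipinf_of_le.
have [_ g0] := T_factor_neq0 Tg; have [_ h0] := T_factor_neq0 Th.
have gest : (0 < n)%N -> exists K (Q : {poly R[i]}), Q != 0 /\ forall w z, cmod w = 1 ->
    cmod z = 1 -> Q.[z] != 0 -> cmod g.[z] ^+ 2 <= K * cmod (eval2 p w z).
  case: n e1 E1 Tg {dX E2} => // n e1 E1 Tg _.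
  apply: in_Ip_sqr_le2 => //; apply: in_Ip_T_factor2 Tg.
    by move=> i j; have [[[_ ->]]] := E1 i.
  by move=> i; case: (E1 i) => [[]].
have hest : (0 < m)%N -> exists K (Q : {poly R[i]}), Q != 0 /\ forall w z, cmod w = 1 ->
    cmod z = 1 -> Q.[w] != 0 -> cmod h.[w] ^+ 2 <= K * cmod (eval2 p w z).
  case: m e2 E2 Th {dY E1} => // m e2 E2 Th _.
  apply: in_Ip_sqr_le1 => //; apply: in_Ip_T_factor1 Th.
    by move=> i; have [[[-> _]]] := E2 i.
  by move=> i; case: (E2 i) => [[]].
have gconst : m = 0%N -> exists2 c : R[i], c != 0 & g = c%:P.
  move=> m0; apply: (T_factor_const Tg); apply: size_det_const => i j.
  rewrite mxE; apply: (leq_trans (size_poly _ _)).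
  by have [[[+ _] _] _] := E1 i; rewrite m0.
have hconst : n = 0%N -> exists2 c : R[i], c != 0 & h = c%:P.
  move=> n0; apply: (T_factor_const Th); apply: size_det_const => i j.
  rewrite mxE.
  by have [[[_ +] _] _] := E2 i => /(_ j); rewrite n0.
have [Bg hBg] := poly_bounded g; have [Bh hBh] := poly_bounded h.
have [n0|n0] := posnP n; have [m0|m0] := posnP m.
(* Here [p] itself is a nonzero constant. *)
- have [c c0 gE] := gconst m0; have [d d0 hE] := hconst n0.
  have sp : (size p <= 1)%N by move: dY; rewrite m0 /degY; case: (size p) => [|[]].
  have pE := size1_polyC sp.
  have sp0 : (size (p`_0)%R <= 1)%N.
    have [p0|p0] := eqVneq (size p) 0%N.
      by move/eqP: p0; rewrite size_poly_eq0 => /eqP ->; rewrite coef0 size_poly0.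
    have i0 : (0 < size p)%N by rewrite lt0n.
    have := @leq_bigmax _ (fun i : 'I_(size p) => (size (p`_i)%R).-1) (Ordinal i0).
    rewrite /= -/(degX p) dX n0 leqn0; by case: (size _) => [|[]].
  exists (cmod d * cmod c / cmod (p`_0)`_0), 1, 1; rewrite !oner_neq0; split => // w z _ _ _ _.
  rewrite gE hE !hornerC pE eval2C (size1_polyC sp0) !coefC/= hornerC mulfVK// cmod_eq0.
  have := bidisk_neq0 hp (w := 0) (z := 0); rewrite cmod0 ltr01 => /(_ isT isT).
  by rewrite {1}pE eval2C (size1_polyC sp0) hornerC coefC.  
(* The estimate for the constant h bounds |p| from below while g is bounded: |c| |g| <= (Bg / |c|)
   |c|^2. *)
- have [c c0 hE] := hconst n0; have [K [Q [Q0 hK]]] := hest m0.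
  have c2 : 0 < cmod c by rewrite cmod_gt0.
  exists (Bg / cmod c * K), Q, 1; rewrite oner_neq0; split => // w z w1 z1 Qw _.
  have := hK w z w1 z1 Qw; rewrite hE hornerC => hc.
  have Gz : cmod g.[z] <= Bg by rewrite hBg// z1.
  have Bg0 : 0 <= Bg by apply: le_trans Gz; exact: cmod_ge0.
  apply: (@le_trans _ _ (Bg / cmod c * cmod c ^+ 2)).
    by rewrite expr2 mulrA divfK ?gt_eqF// mulrC ler_wpM2r// ltW.
  by rewrite -[leRHS]mulrA ler_wpM2l// divr_ge0// ltW.
- have [c c0 gE] := gconst m0; have [K [Q [Q0 hK]]] := gest n0.
  have c2 : 0 < cmod c by rewrite cmod_gt0.
  exists (Bh / cmod c * K), 1, Q; rewrite oner_neq0; split => // w z w1 z1 _ Qz.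
  have := hK w z w1 z1 Qz; rewrite gE hornerC => hc.
  have Hw : cmod h.[w] <= Bh by rewrite hBh// w1.
  have Bh0 : 0 <= Bh by apply: le_trans Hw; exact: cmod_ge0.
  apply: (@le_trans _ _ (Bh / cmod c * cmod c ^+ 2)).
    by rewrite expr2 mulrA divfK ?gt_eqF// ler_wpM2r// ltW.
  by rewrite -[leRHS]mulrA ler_wpM2l// divr_ge0// ltW.
have [K1 [Q1 [Q10 hK1]]] := hest m0; have [K2 [Q2 [Q20 hK2]]] := gest n0.
(* By 2 |h| |g| <= |h|^2 + |g|^2 the two estimates may be added. *)
exists (K1 + K2), Q1, Q2; split => // w z w1 z1 Qw Qz.
have := hK1 w z w1 z1 Qw; have := hK2 w z w1 z1 Qz.
have := sqr_ge0 (cmod h.[w] - cmod g.[z]); have := sqr_ge0 (cmod h.[w] + cmod g.[z]); nra.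
Qed.
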